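(* Let $n>1$ and let $\tau_n$ be a bijection on the set of partitions of $n$ obtained as follows: list the partitions of $n$ in weakly increasing order of crank and, separately, in weakly increasing order of rank (ties broken arbitrarily); then $\tau_n$ sends the $i$-th partition of the first list to the $i$-th partition of the second list. Then $\operatorname{ospt}(n)$ equals the number of partitions $\lambda$ of $n$ such that $\operatorname{crank}(\lambda)-\operatorname{rank}(\tau_n(\lambda))=1$.
   Context: For a partition $\lambda$, $\operatorname{rank}(\lambda)$ is its largest part minus its number of parts. $\operatorname{crank}(\lambda)$ is the largest part of $\lambda$ if $\lambda$ contains no part equal to $1$; otherwise it is the number of parts larger than the number of ones minus the number of ones. For $n>1$, $N(m,n)$ is the number of partitions of $n$ with rank $m$ and $M(m,n)$ is the number of partitions of $n$ with crank $m$. The function is $\operatorname{ospt}(n)=\sum_{m\geq 0}mM(m,n)-\sum_{m\geq 0}mN(m,n)$. *)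

(* Defs.v *)
From mathcomp Require Import all_boot all_order all_algebra.
Set Implicit Arguments. Unset Strict Implicit. Unset Printing Implicit Defensive.
Import Order.TTheory GRing.Theory Num.Theory.
Local Open Scope ring_scope.

Definition is_partition (n : nat) (l : seq nat) : bool :=
  [&& sorted geq l, all (fun x => (0 < x)%N) l & sumn l == n].

Fixpoint cands (n k : nat) : seq (seq nat) :=
  if k is k'.+1 then
    [::] :: [seq x :: s | x <- iota 1 n, s <- cands n k']
  else [:: [::]].

(* The list (without repetition) of all partitions of n; every partition of
   n has at most n parts, each between 1 and n. *)
Definition partitions (n : nat) : seq (seq nat) :=
  undup [seq l <- cands n n | is_partition n l].

Definition largest_part (l : seq nat) : nat := foldr maxn 0 l.

Definition rank (l : seq nat) : int :=
  (largest_part l)%:Z - (size l)%:Z.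

Definition crank (l : seq nat) : int :=
  let w := count (fun x => x == 1) l in
  if w == 0%N then (largest_part l)%:Z
  else (count (fun x => (w < x)%N) l)%:Z - w%:Z.

Definition Nrank (m : int) (n : nat) : nat :=
  count (fun l => rank l == m) (partitions n).
Definition Mcrank (m : int) (n : nat) : nat :=
  count (fun l => crank l == m) (partitions n).

(* ospt(n) = sum_{m>=0} m M(m,n) - sum_{m>=0} m N(m,n); all ranks and cranks
   of partitions of n are at most n, so the sums over m range over 0..n. *)
Definition ospt (n : nat) : int :=
  (\sum_(0 <= m < n.+1) (m * Mcrank m%:Z n))%N%:Z
  - (\sum_(0 <= m < n.+1) (m * Nrank m%:Z n))%N%:Z.

(* Main.v *)
(* The crank and rank distributions are symmetric, so ospt(n) is the difference of
   the sums of the positive parts of crank and rank. It thus suffices that, along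
   the two sorted lists, a positive crank c is matched with a rank in {c - 1, c} and
   a crank c <= 0 with a rank in [c, 0]. In terms of C_j and R_j, the numbers of
   partitions of crank, respectively rank, at least j, this says R_j <= C_j for
   j >= 1 and C_(j+1) <= R_j for j >= 0.

   With P the partition generating function, C_j + q^j C_(j+1) = q^j P and
   R_j + q^(j+1) R_(j+3) = q^(j+1) P, hence
   R_j - C_(j+1) = q^(j+1) (C_(j+2) - R_(j+3)), and the second inequality follows
   from the first. For the first one, both series are decomposed along Durfee
   rectangles. Repeated use of the Pascal rules for Gaussian binomials makes most of
   the difference telescope; what remains is nonnegative by the log-concavity of
   Gaussian binomials. *)
Require Import Defs.
From HB Require Import structures.
From mathcomp Require Import all_boot all_order all_algebra.
From mathcomp Require Import boolp zify ring.
Import Order.TTheory GRing.Theory Num.Theory.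
Set Implicit Arguments. Unset Strict Implicit. Unset Printing Implicit Defensive.
Local Open Scope ring_scope.

(** * Formal power series over the integers *)

Definition fps := nat -> int.

HB.instance Definition _ := gen_eqMixin fps.
HB.instance Definition _ := gen_choiceMixin fps.

Definition fps_mul (f g : fps) : fps := fun n => \sum_(i < n.+1) f i * g (n - i)%N.

Definition fps_trunc N (f : fps) : {poly int} := \poly_(i < N) f i.

Lemma fps_ext (f g : fps) : (forall n, f n = g n) -> f = g.
Proof. exact: funext. Qed.

(** Transports the ring laws from [{poly int}]: a coefficient of a product sees only finitely many
    coefficients of its factors. *)
Lemma fps_mul_trunc N (f g : fps) n : (n < N)%N ->
  fps_mul f g n = (fps_trunc N f * fps_trunc N g)`_n.
Proof.
move=> lt_nN; rewrite coefM; apply: eq_bigr => i _; rewrite !coef_poly.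
have le_in : (i <= n)%N by rewrite -ltnS.
by rewrite (leq_ltn_trans le_in lt_nN) (leq_ltn_trans (leq_subr i n) lt_nN).
Qed.

Lemma fps_addA : associative (fun f g : fps => (fun n => f n + g n) : fps).
Proof. by move=> f g h; apply: fps_ext => n; rewrite addrA. Qed.
Lemma fps_addC : commutative (fun f g : fps => (fun n => f n + g n) : fps).
Proof. by move=> f g; apply: fps_ext => n; rewrite addrC. Qed.
Lemma fps_add0 : left_id ((fun _ => 0) : fps) (fun f g : fps => (fun n => f n + g n) : fps).
Proof. by move=> f; apply: fps_ext => n; rewrite add0r. Qed.
Lemma fps_addN : left_inverse ((fun _ => 0) : fps) (fun f : fps => (fun n => - f n) : fps)
  (fun f g : fps => (fun n => f n + g n) : fps).
Proof. by move=> f; apply: fps_ext => n; rewrite addNr. Qed.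

HB.instance Definition _ := GRing.isZmodule.Build fps fps_addA fps_addC fps_add0 fps_addN.

Definition fps_one : fps := fun n => (n == 0%N)%:R.

Lemma fps_mulC : commutative fps_mul.
Proof.
by move=> f g; apply: fps_ext => n; rewrite !(@fps_mul_trunc n.+1) // mulrC.
Qed.

Lemma fps_mulA : associative fps_mul.
Proof.
move=> f g h; apply: fps_ext => n; rewrite !(@fps_mul_trunc n.+1) //.
(* Truncating an intermediate product is invisible in degrees up to [n]. *)
have coefE (u v w : fps) : (fps_trunc n.+1 (fps_mul u v) * fps_trunc n.+1 w)`_n
    = (fps_trunc n.+1 u * fps_trunc n.+1 v * fps_trunc n.+1 w)`_n.
  rewrite !coefM; apply: eq_bigr => i _; congr (_ * _).
  by rewrite coef_poly ltn_ord (@fps_mul_trunc n.+1).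
by rewrite coefE [in LHS]mulrC coefE [in LHS]mulrC mulrA.
Qed.

Lemma fps_mul1 : left_id fps_one fps_mul.
Proof.
move=> f; apply: fps_ext => n.
rewrite /fps_mul big_ord_recl /= /fps_one eqxx mul1r subn0 big1 ?addr0 // => i _.
by rewrite mul0r.
Qed.

Lemma fps_mulDl : left_distributive fps_mul +%R.
Proof.
move=> f g h; apply: fps_ext => n.
by rewrite /fps_mul [RHS]/GRing.add /= -big_split; apply: eq_bigr => i _; rewrite mulrDl.
Qed.

Lemma fps_one_neq0 : fps_one != 0.
Proof. by apply/eqP => /(congr1 (fun f : fps => f 0%N)). Qed.

HB.instance Definition _ :=
  GRing.Zmodule_isComNzRing.Build fps fps_mulA fps_mulC fps_mul1 fps_mulDl fps_one_neq0.

Lemma fpsD (f g : fps) n : (f + g) n = f n + g n. Proof. by []. Qed.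
Lemma fpsN (f : fps) n : (- f) n = - f n. Proof. by []. Qed.
Lemma fpsB (f g : fps) n : (f - g) n = f n - g n. Proof. by []. Qed.
Lemma fpsM (f g : fps) n : (f * g) n = \sum_(i < n.+1) f i * g (n - i)%N. Proof. by []. Qed.
Lemma fps1 n : (1 : fps) n = (n == 0%N)%:R. Proof. by []. Qed.
Lemma fps_sum I (r : seq I) (P : pred I) (F : I -> fps) n :
  (\sum_(i <- r | P i) F i) n = \sum_(i <- r | P i) F i n.
Proof. by apply: (big_morph (fun f : fps => f n)). Qed.

Definition q : fps := fun n => (n == 1%N)%:R.

Lemma coef_qM f n : (q * f) n = if n is n'.+1 then f n' else 0.
Proof.
case: n => [|n]; rewrite fpsM; first by rewrite big_ord1 mul0r.
rewrite big_ord_recl mul0r add0r big_ord_recl /= mul1r big1 ?addr0 ?subSS ?subn0 //.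
by move=> i _; rewrite mul0r.
Qed.

Lemma coef_qXM k f n : (q ^+ k * f) n = if (n < k)%N then 0 else f (n - k)%N.
Proof.
elim: k n => [|k IH] n; first by rewrite mul1r subn0.
by rewrite exprS -mulrA coef_qM; case: n => [|n] //; rewrite IH ltnS subSS.
Qed.


Definition pos (f : fps) := forall n, 0 <= f n.

Lemma pos0 : pos 0. Proof. by []. Qed.
Lemma pos1 : pos 1. Proof. by case. Qed.
Lemma posD f g : pos f -> pos g -> pos (f + g).
Proof. by move=> f0 g0 n; rewrite fpsD addr_ge0. Qed.
Lemma posM f g : pos f -> pos g -> pos (f * g).
Proof. by move=> f0 g0 n; rewrite fpsM sumr_ge0 // => i _; rewrite mulr_ge0. Qed.
Lemma pos_q : pos q. Proof. by move=> n; rewrite /q; case: eqP. Qed.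
Lemma posX f k : pos f -> pos (f ^+ k).
Proof. by move=> f0; elim: k => [|k IH]; [exact: pos1 | rewrite exprS; exact: posM]. Qed.
Lemma pos_qX k : pos (q ^+ k). Proof. exact/posX/pos_q. Qed.

Lemma pos_qXM_inv k f : pos (q ^+ k * f) -> pos f.
Proof. by move=> h n; have := h (n + k)%N; rewrite coef_qXM ltnNge leq_addl addnK. Qed.

(** Congruence modulo [q ^+ n.+1]; it expresses convergence of series. *)
Definition eqto n (f g : fps) := forall i, (i <= n)%N -> f i = g i.

Lemma eqto_mul n f f' g g' : eqto n f f' -> eqto n g g' -> eqto n (f * g) (f' * g').
Proof.
move=> ff gg i le_in; rewrite !fpsM; apply: eq_bigr => j _.
have le_ji : (j <= i)%N by rewrite -ltnS.
by rewrite ff ?gg // ?(leq_trans (leq_subr _ _)) // (leq_trans le_ji).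
Qed.


Lemma eqto_addqX n k f g : (n < k)%N -> eqto n (f + q ^+ k * g) f.
Proof.
move=> lt_nk i le_in; rewrite fpsD coef_qXM.
by rewrite (leq_ltn_trans le_in lt_nk) addr0.
Qed.

(* Infinite sums: meaningful when the [s]-th term is divisible by [q ^ s]. *)
Definition ssum (F : nat -> fps) : fps := fun n => \sum_(s < n.+1) F s n.

Definition summable (F : nat -> fps) := forall s n, (n < s)%N -> F s n = 0.

Lemma eq_ssum F F' : (forall s, F s = F' s) -> ssum F = ssum F'.
Proof. by move=> FF; apply: fps_ext => n; apply: eq_bigr => s _; rewrite FF. Qed.

Lemma ssumD F F' : ssum (fun s => F s + F' s) = ssum F + ssum F'.
Proof. by apply: fps_ext => n; rewrite fpsD -big_split. Qed.

Lemma ssumN F : ssum (fun s => - F s) = - ssum F.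
Proof. by apply: fps_ext => n; rewrite fpsN -sumrN. Qed.

Lemma ssumB F F' : ssum (fun s => F s - F' s) = ssum F - ssum F'.
Proof. by rewrite ssumD ssumN. Qed.

Lemma pos_ssum F : (forall s, pos (F s)) -> pos (ssum F).
Proof. by move=> F0 n; apply: sumr_ge0 => s _; exact: F0. Qed.

Lemma ssum_widen F n N : summable F -> (n <= N)%N -> ssum F n = \sum_(s < N.+1) F s n.
Proof.
move=> admF le_nN; rewrite /ssum (big_ord_widen_cond N.+1 predT (fun s => F s n)) //=.
rewrite big_mkcond /=; apply: eq_bigr => s _; case: ifP => //.
by rewrite ltnS leqNgt => /negbFE/admF.
Qed.

Lemma summable_qX k F : (forall s, (s <= k s)%N) -> summable (fun s => q ^+ k s * F s).
Proof. by move=> ks s n lt_ns; rewrite coef_qXM (leq_trans lt_ns (ks s)). Qed.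

Lemma summable_mull f F : summable F -> summable (fun s => f * F s).
Proof.
move=> admF s n lt_ns; rewrite fpsM big1 // => i _.
by rewrite admF ?mulr0 // (leq_ltn_trans (leq_subr _ _)).
Qed.

Lemma ssum_mull f F : summable F -> ssum (fun s => f * F s) = f * ssum F.
Proof.
move=> admF; apply: fps_ext => n.
under [RHS]eq_bigr => i _ do rewrite (@ssum_widen F _ n admF (leq_subr i n)) mulr_sumr.
by rewrite exchange_big; apply: eq_bigr.
Qed.

Lemma ssum_recl F : summable F -> ssum F = F 0%N + ssum (fun s => F s.+1).
Proof.
move=> admF; apply: fps_ext => n.
by rewrite fpsD (@ssum_widen F n n.+1) // big_ord_recl.
Qed.

Lemma summable_shift F : summable F -> summable (fun s => F s.+1).
Proof. by move=> admF s n lt_ns; apply: admF; exact: ltnW. Qed.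

Lemma ssum_telescope F : summable F -> ssum (fun s => F s - F s.+1) = F 0%N.
Proof. by move=> admF; rewrite ssumB {1}ssum_recl // addrK. Qed.


(** In degree [n] the sum of increments telescopes to [u n.+1], which already agrees with the limit
    there. *)
Lemma ssum_lim (u : nat -> fps) f : (forall s, eqto s (u s) f) ->
  f = u 0%N + ssum (fun s => u s.+1 - u s).
Proof.
move=> uf; apply: fps_ext => n; rewrite fpsD /ssum.
rewrite -(big_mkord predT (fun s => (u s.+1 - u s) n)).
under eq_bigr do rewrite fpsB.
by rewrite telescope_sumr // addrCA subrr addr0 (uf n.+1).
Qed.

(** * Gaussian binomials *)

(** For positive [a], the expansion of [1 / (1 - q ^+ a)]. *)
Definition geom a : fps := fun n => (a %| n)%:R.

Lemma pos_geom a : pos (geom a). Proof. by move=> n; rewrite /geom; case: (a %| n)%N. Qed.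

Lemma geomK a : (0 < a)%N -> (1 - q ^+ a) * geom a = 1.
Proof.
move=> a_gt0; apply: fps_ext => n.
rewrite mulrBl mul1r fpsB coef_qXM fps1 /geom.
case: ltnP => [lt_na | le_an]; last first.
  by rewrite (dvdn_subl le_an) // subrr; case: n le_an a_gt0 => //; case: a.
rewrite subr0; case: n lt_na => [|n] lt_na; first by rewrite dvdn0.
by rewrite gtnNdvd.
Qed.

Definition qfact n : fps := \prod_(j < n) (1 - q ^+ j.+1).
Definition qfact_inv n : fps := \prod_(j < n) geom j.+1.

Lemma qfact0 : qfact 0 = 1. Proof. exact: big_ord0. Qed.
Lemma qfact_inv0 : qfact_inv 0 = 1. Proof. exact: big_ord0. Qed.
Lemma qfactS n : qfact n.+1 = qfact n * (1 - q ^+ n.+1). Proof. exact: big_ord_recr. Qed.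

Lemma qfact_invE n : qfact_inv n = qfact_inv n.+1 * (1 - q ^+ n.+1).
Proof. by rewrite /qfact_inv big_ord_recr /= -mulrA [geom _ * _]mulrC geomK // mulr1. Qed.

Lemma qfactK n : qfact n * qfact_inv n = 1.
Proof.
elim: n => [|n IH]; first by rewrite qfact0 qfact_inv0 mulr1.
by rewrite qfactS -mulrA [_ * qfact_inv _]mulrC -qfact_invE.
Qed.


(* The Gaussian binomial of index [k + L] over [k]: partitions into at most [L]
   parts, each at most [k]. It is locked so that rewriting with the ring laws
   does not see through it. *)
Definition gauss k L : fps := locked (qfact (k + L) * qfact_inv k * qfact_inv L).

Lemma gaussE k L : gauss k L = qfact (k + L) * qfact_inv k * qfact_inv L.
Proof. by rewrite /gauss -lock. Qed.

Lemma gaussC k L : gauss k L = gauss L k.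
Proof. by rewrite !gaussE addnC -!mulrA [qfact_inv k * _]mulrC. Qed.

Lemma gaussk0 k : gauss k 0 = 1.
Proof. by rewrite !gaussE addn0 qfact_inv0 mulr1 qfactK. Qed.

Lemma gauss0L L : gauss 0 L = 1. Proof. by rewrite gaussC gaussk0. Qed.

Lemma gauss_pascal k L : gauss k.+1 L.+1 = gauss k L.+1 + q ^+ k.+1 * gauss k.+1 L.
Proof.
(* Writing every inverse factorial through the one of larger index clears all denominators, so that
   [ring] decides the identity. *)
rewrite !gaussE addSn addnS addSnnS qfactS (qfact_invE k) (qfact_invE L) !addnS !exprS exprD.
ring.
Qed.

Lemma gauss_pascalr k L : gauss k.+1 L.+1 = gauss k.+1 L + q ^+ L.+1 * gauss k L.+1.
Proof. by rewrite gaussC gauss_pascal gaussC addrC [in RHS]addrC gaussC. Qed.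

Lemma pos_gauss k L : pos (gauss k L).
Proof.
elim: k L => [|k IHk] L; first by rewrite gauss0L; exact: pos1.
elim: L => [|L IHL]; first by rewrite gaussk0; exact: pos1.
rewrite gauss_pascal; apply: posD => //; exact/posM/IHL/pos_qX.
Qed.

(** * Durfee decompositions of the rank and crank series *)

Lemma gauss_ratio k L : (1 - q ^+ L.+1) * gauss k L.+1 = (1 - q ^+ (k + L).+1) * gauss k L.
Proof. rewrite !gaussE addnS qfactS (qfact_invE L); ring. Qed.

Lemma qfact_inv_eqto k : eqto k (qfact_inv k.+1) (qfact_inv k).
Proof.
have -> : qfact_inv k.+1 = qfact_inv k + q ^+ k.+1 * qfact_inv k.+1 by rewrite (qfact_invE k); ring.
exact: eqto_addqX.
Qed.

Lemma gauss_eqto k L : eqto L (gauss k L) (qfact_inv k).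
Proof.
(* The left side is the product of [1 - q ^+ j] over [L < j <= k + L], hence 1 modulo
   [q ^+ L.+1]. *)
have [h hE] : exists h, qfact (k + L) * qfact_inv L = 1 + q ^+ L.+1 * h.
  elim: k => [|k [h IH]]; first by exists 0; rewrite qfactK mulr0 addr0.
  exists (h - q ^+ k - q ^+ (k + L).+1 * h).
  rewrite addSn qfactS mulrAC IH !exprS exprD; ring.
have -> : gauss k L = qfact_inv k + q ^+ L.+1 * (h * qfact_inv k).
  by rewrite !gaussE mulrAC hE; ring.
exact: eqto_addqX.
Qed.

(** Euler's product, read on the diagonal: factors beyond the [n]-th change only degrees above
    [n]. *)
Definition partition_gf : fps := fun n => qfact_inv n n.

Lemma qfact_inv_partition_gf k : eqto k (qfact_inv k) partition_gf.
Proof.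
move=> i le_ik; rewrite /partition_gf -(subnK le_ik).
elim: (k - i)%N => [|d IH] //; rewrite addSn qfact_inv_eqto ?leq_addl //.
Qed.

Lemma gauss_partition_gf s c : eqto s (gauss (s + c) s) partition_gf.
Proof.
move=> i le_is.
by rewrite (gauss_eqto _ le_is) (qfact_inv_partition_gf (leq_trans le_is (leq_addr c s))).
Qed.

(* Cut a partition in a box along its largest rectangle of size [d] by [d + c]. *)
Lemma gauss_vandermonde c x Y : gauss (c + x) Y =
  \sum_(d < x.+1) q ^+ (d * (d + c)) * gauss (x - d) d
                  * (if (d <= Y)%N then gauss (d + c) (Y - d) else 0).
Proof.
(* Extended by zero, [B] satisfies the Pascal rule [BS] also at the boundary [d = y]. *)
pose B x d : fps := if (d <= x)%N then gauss (x - d) d else 0.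
pose H c Y d : fps := if (d <= Y)%N then gauss (d + c) (Y - d) else 0.
transitivity (\sum_(d < x.+1) q ^+ (d * (d + c)) * B x d * H c Y d); last first.
  by apply: eq_bigr => d _; rewrite /B -ltnS ltn_ord.
have B0 y : B y 0%N = 1 by rewrite /B gaussk0.
have BS y d : (d <= y)%N -> B y.+1 d.+1 = B y d.+1 + q ^+ (y - d) * B y d.
  rewrite /B ltnS subSS => le_dy; rewrite le_dy; case: ltngtP le_dy => // [lt_dy | ->] _.
    by rewrite -(prednK (_ : 0 < y - d)%N) ?subn_gt0 // gauss_pascal -subnS.
  by rewrite subnn !gauss0L add0r mulr1.
(* Pascal's rule on [B] splits the sum into the one for [x], [c], [Y] and, after a shift of [d],
   [q ^+ (c + x).+1] times the one for [x], [c.+1], [Y.-1]; these are the two terms of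
   [gauss_pascal]. *)
elim: x c Y => [|x IH] c Y.
  by rewrite big_ord1 /B /H /= addn0 mul0n gaussk0 !mul1r subn0 add0n.
rewrite big_ord_recl B0.
under eq_bigr => d _.
  rewrite (_ : B _ _ = B x d.+1 + q ^+ (x - d) * B x d); last by apply: BS; rewrite -ltnS.
  rewrite mulrDr mulrDl; over.
rewrite big_split /= addrA.
have -> : q ^+ (0 * (0 + c)) * 1 * H c Y 0%N
    + \sum_(d < x.+1) q ^+ (d.+1 * (d.+1 + c)) * B x d.+1 * H c Y d.+1 = gauss (c + x) Y.
  rewrite IH -(B0 x) -(big_ord_recl _ (fun d : 'I_x.+2 => q ^+ (d * (d + c)) * B x d * H c Y d)).
  by rewrite big_ord_recr /= {2}/B ltnn mulr0 mul0r addr0.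
case: Y => [|Y].
  by rewrite big1 ?addr0 ?gaussk0 // => d _; rewrite /H /= mulr0.
rewrite addnS gauss_pascal; congr (_ + _).
rewrite -addnS -addSnnS IH mulr_sumr; apply: eq_bigr => d _.
rewrite /H ltnS subSS -addSnnS !mulrA -!exprD; congr (_ ^+ _ * _ * _).
have le_dx : (d <= x)%N by rewrite -ltnS.
by rewrite /bump leq0n add1n -{1}(subnKC le_dx); nia.
Qed.

(* For [n > 1], the coefficients of [crank_ge j] and [rank_ge j] at [n] are the numbers of
   partitions of [n] of crank, respectively rank, at least [j]. *)
Definition crank_ge j := ssum (fun d => q ^+ (d.+1 * (d + j)) * (qfact_inv d * qfact_inv (d + j))).
Definition rank_ge j := ssum (fun l => q ^+ (l + j).+1 * gauss (l + j).+1 l).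

(** [partition_gf] is the limit of [gauss (l + m.+2) l]. One Pascal rule in each direction splits
    every increment into a term of [rank_ge m], freed of [q ^+ m.+1], and a term of
    [rank_ge m.+3]. *)
Lemma rank_ge_rec m : rank_ge m + q ^+ m.+1 * rank_ge m.+3 = q ^+ m.+1 * partition_gf.
Proof.
pose F1 l := q ^+ l * gauss (l + m.+1) l.
pose F2 l := q ^+ (l + m.+4) * gauss (l + m.+4) l.
(* [F2] delayed by one index, to match the increments term by term. *)
pose F3 l := if l is l'.+1 then F2 l' else 0.
have aF1 : summable F1 by apply: summable_qX.
have aF2 : summable F2 by apply: summable_qX => s; lia.
have aF3 : summable F3 by move=> [|s] n lt_ns; [|rewrite /F3 /F2 coef_qXM ifT //; lia].
have -> : rank_ge m = q ^+ m.+1 * ssum F1.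
  rewrite /rank_ge -ssum_mull //; apply: eq_ssum => l.
  by rewrite /F1 addnS mulrA -exprD addSn [(m + l)%N]addnC.
have -> : rank_ge m.+3 = ssum F2 by apply: eq_ssum => l; rewrite /F2 !addnS.
rewrite -mulrDr; congr (_ * _).
have -> : ssum F2 = ssum F3 by rewrite [in RHS]ssum_recl //= add0r.
rewrite (@ssum_lim (fun l => gauss (l + m.+2) l) partition_gf); last by move=> s; exact: gauss_partition_gf.
rewrite ssum_recl // /F1 expr0 !gaussk0 mulr1 -addrA -ssumD; congr (_ + _).
apply: eq_ssum => -[|l] /=.
  by rewrite addr0 !add0n !add1n [gauss m.+3 _]gauss_pascalr !gaussk0; ring.
rewrite /F2 !addSn !addnS [gauss _.+4 l.+2]gauss_pascalr [gauss _.+4 l.+1]gauss_pascal !exprS exprD.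
ring.
Qed.

Lemma durfee j : ssum (fun d => q ^+ (d * (d + j)) * (qfact_inv d * qfact_inv (d + j))) = partition_gf.
Proof.
apply: fps_ext => n; rewrite -(@gauss_partition_gf n j n) // addnC gauss_vandermonde fps_sum.
apply: eq_bigr => d _; have le_dn : (d <= n)%N by rewrite -ltnS.
rewrite le_dn -mulrA !coef_qXM; case: ltnP => // le_ddn.
(* As [d <= d * (d + j)], agreement with the limits up to degree [n - d] suffices. *)
apply/esym/(@eqto_mul (n - d)) => [||]; [|exact: gauss_eqto | nia].
rewrite gaussC; exact: gauss_eqto.
Qed.

Lemma adm_crank_ge j : summable (fun d => q ^+ (d.+1 * (d + j)) * (qfact_inv d * qfact_inv (d + j))).
Proof. apply: summable_qX => s; nia. Qed.

(** Term [d.+1] of the first series and term [d] of the second add up, by [qfact_invE], to term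
    [d.+1] of the Durfee expansion on the right. *)
Lemma crank_ge_rec j : crank_ge j + q ^+ j * crank_ge j.+1 = q ^+ j * partition_gf.
Proof.
have aD : summable (fun d => q ^+ (d * (d + j)) * (qfact_inv d * qfact_inv (d + j))).
  by apply: summable_qX => s; nia.
rewrite -(durfee j) -!ssum_mull //; last exact: adm_crank_ge.
rewrite [crank_ge j]ssum_recl; last exact: adm_crank_ge.
rewrite [RHS]ssum_recl; last exact: summable_mull.
rewrite -addrA -ssumD; congr (_ + _).
  by rewrite mul1n mul0n expr0 mul1r.
apply: eq_ssum => d; rewrite -[(d + j.+1)%N]addSnnS (qfact_invE d) mulSn !exprD; ring.
Qed.

Lemma ssum_diag (T : nat -> nat -> fps) :
  (forall e s n, (n < e + s)%N -> T e s n = 0) ->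
  ssum (fun l => \sum_(e < l.+1) T e (l - e)%N) = ssum (fun e => ssum (T e)).
Proof.
move=> T0; apply: fps_ext => n; rewrite /ssum.
pose U l e := if (e <= l)%N then T e (l - e)%N n else 0.
transitivity (\sum_(l < n.+1) \sum_(e < n.+1) U l e).
  apply: eq_bigr => l _; rewrite fps_sum.
  rewrite (big_ord_widen_cond n.+1 predT (fun e => T e (l - e)%N n)) //= big_mkcond /=.
  by apply: eq_bigr => e _; rewrite ltnS.
rewrite exchange_big; apply: eq_bigr => e _.
have le_en : (e <= n.+1)%N by exact: ltnW.
rewrite -(big_mkord predT (fun l => U l e)) -(big_mkord predT (fun s => T e s n)).
rewrite (@big_cat_nat _ _ _ e) //= big_nat big1 ?add0r; last first.
  by move=> l /andP[_ lt_le]; rewrite /U leqNgt lt_le.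
rewrite -{1}(add0n (e : nat)) big_addn.
rewrite [RHS](@big_cat_nat _ _ _ (n.+1 - e)) ?leq_subr //= [X in _ + X]big_nat.
rewrite [X in _ + X]big1 ?addr0; last by move=> s /andP[le_s _]; apply: T0; lia.
by apply: eq_bigr => s _; rewrite /U leq_addl addnK.
Qed.

(** Each Gaussian binomial in [rank_ge] is cut by [gauss_vandermonde], and the double sum is
    regrouped by rectangle size with [s = l - e]. *)
Lemma rank_ge_durfee m : rank_ge m.+1 = ssum (fun e => q ^+ (e.+1 * (m + e).+1) *
  ssum (fun s => q ^+ s.+1 * (gauss e s.+1 * gauss (m + e).+1 s))).
Proof.
pose T e s := q ^+ (e.+1 * (m + e).+1) * (q ^+ s.+1 * (gauss e s.+1 * gauss (m + e).+1 s)).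
transitivity (ssum (fun e => ssum (T e))); last first.
  by apply: eq_ssum => e; rewrite ssum_mull //; exact: summable_qX.
rewrite -ssum_diag => [|e s n lt_n]; last first.
  by rewrite /T mulrA -exprD coef_qXM ifT //; nia.
apply: eq_ssum => l.
rewrite (_ : (l + m.+1).+1 = m.+1 + l.+1)%N; last by lia.
(* The last rectangle, [d = l.+1], exceeds [Y = l] and contributes zero. *)
rewrite gauss_vandermonde big_ord_recr /= ltnn mulr0 addr0 mulr_sumr.
apply: eq_bigr => e _; have le_el : (e <= l)%N by rewrite -ltnS.
rewrite le_el /T subSn // [gauss (l - e).+1 e]gaussC !mulrA -!exprD [(e + m.+1)%N]addnS [(e + m)%N]addnC.
congr (q ^+ _ * _ * _); move: (nat_of_ord e) le_el => {}e le_el.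
by rewrite -{1}(subnKC le_el); nia.
Qed.

(** At [a = m + e], the contribution of Durfee size [e] to the difference of the crank and rank
    series, without its weight [durfee_wt m e]. *)
Definition inner e a := ssum (fun s => q ^+ s * (gauss e s * (gauss a s - q ^+ e.+1 * gauss a.+1 s))).

(** The product of inverses is the limit of [gauss e s * gauss a.+1 s]; the subtracted series is
    absorbed by the increments, and [gauss_ratio] rewrites the rest. *)
Lemma inner_lim e a : qfact_inv e * qfact_inv a.+1
  - ssum (fun s => q ^+ s.+1 * (gauss e s.+1 * gauss a.+1 s)) = inner e a.
Proof.
rewrite (@ssum_lim (fun s => gauss e s * gauss a.+1 s) (qfact_inv e * qfact_inv a.+1)); last first.
  by move=> s; apply: eqto_mul; exact: gauss_eqto.
rewrite /inner !gaussk0 mulr1 -addrA -ssumB.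
have -> : (fun s => q ^+ s * (gauss e s * (gauss a s - q ^+ e.+1 * gauss a.+1 s))) =
   (fun s => q ^+ s * (gauss e s * gauss a s) - q ^+ s * (q ^+ e.+1 * (gauss e s * gauss a.+1 s))).
  by apply: funext => s; ring.
rewrite [RHS]ssumB [ssum (fun s => q ^+ s * (gauss e s * gauss a s))]ssum_recl; last exact: summable_qX.
rewrite !gaussk0 !mulr1 expr0 -addrA -ssumB; congr (_ + _); apply: eq_ssum => s.
have := gauss_ratio e s; rewrite gauss_pascalr -addnS exprD => gaussE.
have {gaussE} -> : q ^+ s * (q ^+ e.+1 * (gauss e s * gauss a.+1 s)) =
   (gauss e s - (1 - q ^+ s.+1) * gauss e s.+1) * gauss a.+1 s by rewrite gaussE !exprS; ring.
ring.
Qed.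

Definition durfee_wt m e := q ^+ (e.+1 * (m + e).+1).

Lemma crank_ge_sub_rank_ge m : crank_ge m.+1 - rank_ge m.+1 = ssum (fun e => durfee_wt m e * inner e (m + e)).
Proof.
rewrite rank_ge_durfee /crank_ge -ssumB; apply: eq_ssum => e.
by rewrite -inner_lim mulrBr addnS [(e + m)%N]addnC.
Qed.

(** * Positivity of the difference *)

Lemma posB_trans f g h : pos (f - g) -> pos (g - h) -> pos (f - h).
Proof. by move=> fg gh; have := posD fg gh; rewrite addrA subrK. Qed.

(** All pairs of equal sum are compared, because in the coefficientwise order the inequalities for
    neighbours do not imply the others. *)
Definition logconcave (u : nat -> fps) :=
  forall a b c d, (c <= a)%N -> (c <= b)%N -> (a + b = c + d)%N ->
    pos (u a * u b - u c * u d).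

(* Passing from [u] to [v] multiplies the generating function by [1 / (1 - x z)]. *)
Lemma logconcave_geometric (u v : nat -> fps) (x : fps) :
    pos x -> (forall k, pos (v k)) -> (forall k, pos (u k)) ->
    v 0%N = u 0%N -> (forall k, v k.+1 = u k.+1 + x * v k) ->
  logconcave u -> logconcave v.
Proof.
move=> x0 v_ge0 u_ge0 v0 vS lcu.
(* Mixed minors of [u] and [v] serve for neighbouring minors of [v], where the terms [x * v p * v r]
   cancel. *)
have mixed p r a d : (p <= r)%N -> (p <= a)%N -> (a + r = p + d)%N ->
    pos (u a * v r - v p * u d).
  elim: p r => [|p IH] r le_pr le_pa sumE.
    rewrite v0 (_ : _ - _ = (u a * u r - u 0%N * u d) + u a * (v r - u r)); last by ring.
    apply: posD; first exact: lcu.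
    apply: posM => //; case: {sumE le_pr} r => [|r]; first by rewrite v0 subrr; exact: pos0.
    by rewrite vS addrC addKr; exact: posM.
  case: r le_pr sumE => // r le_pr sumE; rewrite !vS.
  rewrite (_ : _ - _ = (u a * u r.+1 - u p.+1 * u d) + x * (u a * v r - v p * u d)); last by ring.
  apply: posD; first exact: lcu.
  by apply/posM/IH => //; [exact: ltnW | lia].
have adjacent p r : (p <= r)%N -> pos (v p.+1 * v r - v p * v r.+1).
  move=> le_pr; rewrite !vS (_ : _ - _ = u p.+1 * v r - v p * u r.+1); last by ring.
  by apply: mixed => //; lia.
have spread k b c : (c + k <= b)%N -> pos (v (c + k)%N * v b - v c * v (b + k)%N).
  elim: k b => [|k IH] b le_b; first by rewrite !addn0 subrr; exact: pos0.
  apply: (@posB_trans _ (v (c + k)%N * v b.+1)).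
    by rewrite addnS; apply: adjacent; lia.
  by rewrite addnS -addSn; apply: IH; lia.
move=> a b c d; wlog le_ab : a b / (a <= b)%N => [th|] le_ca le_cb sumE.
  by case/orP: (leq_total a b) => le_ab; [|rewrite mulrC]; apply: th => //; lia.
rewrite -(subnKC le_ca) (_ : d = b + (a - c))%N; last by lia.
by apply: spread; lia.
Qed.

(** By [gauss_pascalr], passing from [s] to [s.+1] is a geometric step of ratio [q ^+ s.+1]. *)
Lemma gauss_logconcave s : logconcave (fun k => gauss k s).
Proof.
elim: s => [|s IH]; first by move=> a b c d _ _ _; rewrite !gaussk0 subrr; exact: pos0.
apply: (@logconcave_geometric (fun k => gauss k s) _ (q ^+ s.+1)) => //.
- exact: pos_qX.
- by move=> k; exact: pos_gauss.
- by move=> k; exact: pos_gauss.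
- by rewrite !gauss0L.
- by move=> k; exact: gauss_pascalr.
Qed.

(** Adding [q ^+ s.+1 * gauss i s.+1 * gauss p s.+1] to both products completes them to a minor of
    the log-concave sequence. *)
Lemma gauss_minor i p s : (i <= p)%N ->
  pos (gauss p s.+1 * gauss i.+1 s - gauss i s.+1 * gauss p.+1 s).
Proof.
move=> le_ip.
have -> : gauss p s.+1 * gauss i.+1 s - gauss i s.+1 * gauss p.+1 s
   = gauss i.+1 s.+1 * gauss p s.+1 - gauss i s.+1 * gauss p.+1 s.+1.
  by rewrite !gauss_pascalr; ring.
by apply: (@gauss_logconcave s.+1); lia.
Qed.

Lemma gauss_mono k L d : pos (gauss k (L + d) - gauss k L).
Proof.
elim: d => [|d IH]; first by rewrite addn0 subrr; exact: pos0.
apply: posB_trans IH; rewrite addnS; case: k => [|k].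
  by rewrite !gauss0L subrr; exact: pos0.
by rewrite gauss_pascalr addrC addKr; apply/posM/pos_gauss/pos_qX.
Qed.

(** Combinatorially, adjoining a part 1 embeds the smaller box into the larger one. *)
Lemma gauss_mono_q k L : pos (gauss k.+1 L.+1 - q * gauss k.+1 L).
Proof.
elim: k L => [|k IHk] L.
  rewrite [gauss _ L.+1]gauss_pascal gauss0L expr1 addrK; exact: pos1.
elim: L => [|L IHL].
  rewrite gauss_pascal (_ : _ - _ = (gauss k.+1 1 - q * gauss k.+1 0) + q ^+ k.+2 * gauss k.+2 0).
    by apply: posD => //; apply/posM/pos_gauss/pos_qX.
  by rewrite !gaussk0; ring.
rewrite [gauss k.+2 L.+2]gauss_pascal [in X in q * X]gauss_pascal.
rewrite (_ : _ - _ = (gauss k.+1 L.+2 - q * gauss k.+1 L.+1) + q ^+ k.+2 * (gauss k.+2 L.+1 - q * gauss k.+2 L)); last by ring.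
by apply: posD => //; apply/posM/IHL/pos_qX.
Qed.

Lemma pos_ssum_shift c F : summable F -> (forall s, pos (F s)) ->
  pos (ssum F - ssum (fun s => F (s + c)%N)).
Proof.
move=> + F0; elim: c F F0 => [|c IH] F F0 aF.
  rewrite (_ : (fun s => F (s + 0)%N) = F) ?subrr; first exact: pos0.
  by apply: funext => s; rewrite addn0.
apply: (@posB_trans _ (ssum (fun s => F s.+1))).
  by rewrite ssum_recl // addrK.
have -> : (fun s => F (s + c.+1)%N) = (fun s => F (s + c).+1).
  by apply: funext => s; rewrite addnS.
by apply: (IH (fun s => F s.+1)) => //; exact: summable_shift.
Qed.

(* The [h]-sum is compared with the [w]-sum after moving its index by [c]. *)
Lemma pos_ssum_lag c e (h w : nat -> fps) : (forall s, pos (h s)) ->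
    (forall s, pos (h (s + c)%N - q ^+ e * w s)) ->
  pos (ssum (fun s => q ^+ s.*2 * (h s - q ^+ (c.*2 + e) * w s))).
Proof.
move=> h0 hw.
have -> : (fun s => q ^+ s.*2 * (h s - q ^+ (c.*2 + e) * w s)) =
    (fun s => q ^+ s.*2 * h s - q ^+ s.*2 * (q ^+ (c.*2 + e) * w s)).
  by apply: funext => s; rewrite mulrBr.
rewrite ssumB; apply: (@posB_trans _ (ssum (fun s => q ^+ (s + c).*2 * h (s + c)%N))).
  apply: (@pos_ssum_shift c (fun s => q ^+ s.*2 * h s)); first by apply: summable_qX => s; lia.
  by move=> s; apply: posM => //; exact: pos_qX.
rewrite -ssumB; apply: pos_ssum => s.
rewrite (_ : _ - _ = q ^+ (s + c).*2 * (h (s + c)%N - q ^+ e * w s)).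
  by apply: posM => //; exact: pos_qX.
rewrite doubleD !exprD; ring.
Qed.

Lemma ssum_pascal (F F' H : nat -> fps) : summable F -> summable F' -> F 0%N = F' 0%N ->
  (forall s, F s.+1 = F' s.+1 + H s) -> ssum F = ssum F' + ssum H.
Proof.
move=> aF aF' F0 FS; rewrite ssum_recl // [ssum F']ssum_recl // F0 -addrA -ssumD.
by congr (_ + _); apply: eq_ssum.
Qed.

(** * Telescoping over the Durfee size *)

Definition P1 i p := ssum (fun s => q ^+ s * (gauss i s * gauss p.+1 s)).
Definition V i p := ssum (fun s =>
  q ^+ (s.*2 + i + 3) * (gauss i.+1 s * gauss p s.+1 - q ^+ (p + 3) * (gauss i s.+1 * gauss p.+1 s))).
Definition N32 i p := ssum (fun s => q ^+ (s.*2 + i + p.*2 + 10) * (gauss i s.+2 * gauss p.+2 s)).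

(* In [inner], the terms [P1] telescope from one Durfee size to the next; [N32]
   is absorbed by [V] of the next size, which leaves the series [Psi]. *)
Lemma inner_succ i p :
  inner i.+1 p.+1 = P1 i p + V i p - q ^+ (i + p + 5) * P1 i.+1 p.+1 - N32 i p.
Proof.
(* [X1] and [X2] are the two halves of [inner]. Expanding both Gaussian factors of each by Pascal's
   rules produces a common series [Y], which cancels. *)
pose X1 s := q ^+ s * (gauss i.+1 s * gauss p.+1 s).
pose X2 s := q ^+ (s + i + 2) * (gauss i.+1 s * gauss p.+2 s).
pose Y s := q ^+ (s + i + 2) * (gauss i.+1 s * gauss p.+1 s).
pose X3 s := q ^+ (s.*2 + i + 3) * (gauss i.+1 s * gauss p s.+1).
pose X4 s := q ^+ (s.*2 + i + p + 6) * (gauss i s.+1 * gauss p.+2 s).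
pose X5 s := q ^+ (s.*2 + i + p + 6) * (gauss i s.+1 * gauss p.+1 s).
pose Z1 s := q ^+ s * (gauss i s * gauss p.+1 s).
pose Z2 s := q ^+ (s + i + p + 5) * (gauss i.+1 s * gauss p.+2 s).
have aX1 : summable X1 by apply: summable_qX => s; lia.
have aX2 : summable X2 by apply: summable_qX => s; lia.
have aY : summable Y by apply: summable_qX => s; lia.
have aX4 : summable X4 by apply: summable_qX => s; lia.
have aX5 : summable X5 by apply: summable_qX => s; lia.
have aZ1 : summable Z1 by apply: summable_qX => s; lia.
have -> : inner i.+1 p.+1 = ssum X1 - ssum X2.
  rewrite /inner -ssumB; apply: eq_ssum => s; rewrite /X1 /X2 !exprD !exprS; ring.
have -> : V i p = ssum X3 - ssum X5.
  rewrite /V -ssumB; apply: eq_ssum => s; rewrite /X3 /X5 !exprD; ring.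
have -> : q ^+ (i + p + 5) * P1 i.+1 p.+1 = ssum Z2.
  rewrite /P1 -ssum_mull; last exact: summable_qX.
  by apply: eq_ssum => s; rewrite /Z2 !exprD; ring.
have -> : ssum X1 = ssum Z1 + ssum (fun s => Y s + X3 s).
  apply: ssum_pascal => // [|s]; first by rewrite /X1 /Z1 !gaussk0.
  rewrite /X1 /Z1 /Y /X3 [gauss i.+1 s.+1]gauss_pascal [gauss p.+1 s.+1]gauss_pascalr -addnn !exprD !exprS; ring.
have -> : ssum X2 = ssum Y + ssum (fun s => Z2 s + X4 s).
  apply: ssum_pascal => // [|s]; first by rewrite /X2 /Y !gaussk0.
  rewrite /X2 /Z2 /Y /X4 [gauss p.+2 s.+1]gauss_pascal [gauss i.+1 s.+1]gauss_pascalr -addnn !exprD !exprS; ring.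
rewrite !ssumD; have -> : ssum X4 = ssum X5 + N32 i p.
  apply: ssum_pascal => // [|s]; first by rewrite /X4 /X5 !gaussk0.
  by rewrite /X4 /X5 [gauss p.+2 _]gauss_pascal -!addnn !exprD !exprS; ring.
rewrite -[P1 i p]/(ssum Z1); ring.
Qed.

(** Start of the telescoping: the [P1 0 m] here cancels against the one in the first telescoped
    term. *)
Lemma inner_0 m :
  inner 0 m = (1 - q) * ssum (fun s => q ^+ s * gauss m s) - q ^+ (m + 3) * P1 0 m.
Proof.
pose X1 s := q ^+ s * gauss m s.
pose X2 s := q ^+ s.+1 * gauss m.+1 s.
have aX1 : summable X1 by exact: summable_qX.
have aX2 : summable X2 by exact: summable_qX.
have -> : inner 0 m = ssum X1 - ssum X2.
  rewrite /inner -ssumB; apply: eq_ssum => s; rewrite /X1 /X2 gauss0L !exprS expr0; ring.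
have -> : ssum X2 = ssum (fun s => q * X1 s) + ssum (fun s => q ^+ (m + 3) * (q ^+ s * (gauss 0 s * gauss m.+1 s))).
  apply: (ssum_pascal aX2 (summable_mull q aX1)) => [|s]; first by rewrite /X2 /X1 !gaussk0; ring.
  by rewrite /X2 /X1 gauss_pascal gauss0L !exprD !exprS; ring.
rewrite !ssum_mull //; last exact: summable_qX.
rewrite /P1; ring.
Qed.

Definition Psi i m := ssum (fun s => q ^+ s.*2 * (gauss (m + i).+1 s.+1 * gauss i.+2 s
  - q ^+ (m + i + 4) * (gauss i.+1 s.+1 * gauss (m + i).+2 s)
  - q ^+ m.+1 * (gauss i s.+2 * gauss (m + i).+2 s))).

Lemma V_sub_N32 i m : q ^+ (i + (m + i) + 5) * V i.+1 (m + i).+1 - N32 i (m + i)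
  = q ^+ (m + i.*2 + i + 9) * Psi i m.
Proof.
rewrite /V /N32 /Psi -!ssum_mull; try by apply: summable_qX => s; lia.
rewrite -ssumB; apply: eq_ssum => s.
rewrite -!addnn !exprD !exprS !exprD; ring.
Qed.

Lemma gauss_monoS k L : pos (gauss k L.+1 - gauss k L).
Proof. by rewrite -addn1; exact: gauss_mono. Qed.

(** Pascal's rule on [gauss i.+1 s.+2] splits [Psi] into a sum of minors and two sums of the form
    treated by [pos_ssum_lag]. *)
Lemma pos_Psi_gt0 i m : (0 < m)%N -> pos (Psi i m).
Proof.
move=> m_gt0; set p := (m + i)%N.
pose h s := gauss i.+1 s.+1 * gauss p.+2 s.
pose w s := gauss i.+1 s.+2 * gauss p.+2 s.
(* Moving the index by [c] accounts for [q ^+ c.*2]; the parity [e] of [m.+1] is left over. *)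
pose c := m.+1./2; pose e : nat := odd m.+1.
have cE : (c.*2 + e = m.+1)%N by rewrite addnC odd_double_half.
have h0 s : pos (h s) by apply: posM; exact: pos_gauss.
have -> : Psi i m =
   ssum (fun s => q ^+ s.*2 * (gauss p.+1 s.+1 * gauss i.+2 s - gauss i.+1 s.+1 * gauss p.+2 s))
   + ssum (fun s => q ^+ s.*2 * (h s - q ^+ (c.*2 + e) * w s))
   + q ^+ p.+2 * ssum (fun s => q ^+ s.*2 * (h s - q ^+ (1.*2 + 0) * h s)).
  rewrite -ssum_mull; last by apply: summable_qX => s; lia.
  rewrite -!ssumD; apply: eq_ssum => s; rewrite cE /h /w [gauss i.+1 s.+2]gauss_pascal /p.
  by rewrite !exprD !exprS !exprD; ring.
apply: posD; first apply: posD.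
- by apply: pos_ssum => s; apply: posM; [exact: pos_qX | apply: gauss_minor; rewrite /p; lia].
- apply: pos_ssum_lag => // s; rewrite /h /w.
  (* Here [0 < m] enters: it makes [c] positive. *)
  have [c' ->] : exists c', c = c'.+1 by exists c.-1; rewrite /c; lia.
  rewrite (_ : _ - _ = (gauss i.+1 (s.+2 + c') - gauss i.+1 s.+2) * gauss p.+2 (s + c'.+1)
     + gauss i.+1 s.+2 * (gauss p.+2 (s + c'.+1) - q ^+ e * gauss p.+2 s)); last first.
    by rewrite (_ : (s + c'.+1).+1 = s.+2 + c')%N; [ring | lia].
  apply: posD; apply: posM; try exact: pos_gauss; first exact: gauss_mono.
  rewrite /e; case: (odd _); last by rewrite expr0 mul1r; exact: gauss_mono.
  apply: (@posB_trans _ (gauss p.+2 s.+1)); first by rewrite addnS -addSn; exact: gauss_mono.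
  by rewrite expr1; exact: gauss_mono_q.
- apply: posM; [exact: pos_qX | apply: pos_ssum_lag => // s].
  rewrite expr0 mul1r /h addn1 (_ : _ - _ = (gauss i.+1 s.+2 - gauss i.+1 s.+1) * gauss p.+2 s.+1
     + gauss i.+1 s.+1 * (gauss p.+2 s.+1 - gauss p.+2 s)); last by ring.
  by apply: posD; apply: posM; try exact: pos_gauss; exact: gauss_monoS.
Qed.

(* The q-Narayana number counting plane partitions in a 2 x c x L box. *)
Definition narayana c L : fps :=
  qfact (c + L) * qfact (c + L).+1 * (1 - q) * qfact_inv c * qfact_inv c.+1 * qfact_inv L * qfact_inv L.+1.

(** For positive first index, a power of [q] times the series is a neighbouring minor of Gaussian
    binomials; for index 0 the series is 1. *)
Lemma pos_narayana c L : pos (narayana c L).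
Proof.
case: c => [|c].
  rewrite (_ : narayana 0 L = 1); first exact: pos1.
  have := qfactK 1; rewrite qfactS qfact0 mul1r expr1 => q1K.
  rewrite (_ : narayana 0 L = (qfact L * qfact_inv L) * (qfact L.+1 * qfact_inv L.+1) * ((1 - q) * qfact_inv 1) * qfact_inv 0).
    by rewrite !qfactK q1K qfact_inv0 !mulr1.
  rewrite /narayana add0n; ring.
apply: (@pos_qXM_inv c.+1).
have -> : q ^+ c.+1 * narayana c.+1 L
    = gauss c.+1 L.+1 * gauss c.+1 L.+1 - gauss c L.+1 * gauss c.+2 L.+1.
  rewrite /narayana !gaussE !addSn !addnS !qfactS (qfact_invE c) (qfact_invE c.+1) (qfact_invE L) !exprS exprD.
  ring.
by apply: (@gauss_logconcave L.+1); lia.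
Qed.

(** The factor [1 - q ^+ 2] is the one that [geom 2] cancels in [pos_Psi_0]. *)
Lemma narayana_rec i s : narayana i.+1 s.+1 - narayana i.+1 s =
  (1 - q ^+ 2) * (q ^+ s.+1 * (gauss i.+1 s.+1 * gauss i s.+1)
                  + q ^+ (s + i + 3) * (gauss i.+2 s * (gauss i s.+1 * geom s.+2)))
  + q ^+ (s.*2 + 4) * narayana i s.+1.
Proof.
have GgE : gauss i s.+1 * geom s.+2 = qfact (i + s).+1 * qfact_inv i * qfact_inv s.+2.
  by rewrite gaussE addnS [qfact_inv s.+2]big_ord_recr mulrA.
rewrite GgE /narayana !gaussE !addSn !addnS !qfactS (qfact_invE i) (qfact_invE i.+1) (qfact_invE s) (qfact_invE s.+1).
rewrite -addnn ?addn0 ?addSn ?addnS !exprS !exprD; ring.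
Qed.

(* Up to the telescoping [T s - q ^ 2 * T s.+1], the summand of [Psi i 0] is the
   manifestly nonnegative [U s]. *)
Lemma pos_Psi_0 i : pos (Psi i 0).
Proof.
(* A closed form of [gauss i.+2 s.-1] that vanishes at [s = 0]. *)
pose Z s := (1 - q ^+ s) * (qfact (i + s).+1 * qfact_inv i.+2 * qfact_inv s).
have Z0 : Z 0%N = 0 by rewrite /Z expr0 subrr mul0r.
have ZS s : Z s.+1 = gauss i.+2 s.
  by rewrite /Z gaussE (qfact_invE s) !addSn addnS; ring.
pose T s := q ^+ i.+2 * (gauss i.+1 s.+1 * Z s) + geom 2 * narayana i.+1 s.
pose U s := q ^+ (i + 6 + s) * (gauss i s.+2 * gauss i.+2 s)
  + geom 2 * (q ^+ (s.*2 + 4) * narayana i s.+1)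
  + q ^+ (s + i + 3) * (gauss i.+2 s * (gauss i s.+1 * geom s.+2)).
have aT : summable (fun s => q ^+ s.*2 * T s) by apply: summable_qX => s; lia.
suff -> : Psi i 0 = ssum (fun s => q ^+ s.*2 * U s)
    + ssum (fun s => q ^+ s.*2 * T s - q ^+ s.+1.*2 * T s.+1).
  rewrite ssum_telescope // mul1r /T Z0 !mulr0 add0r; apply: posD; last first.
    by apply: posM; [exact: pos_geom | exact: pos_narayana].
  apply: pos_ssum => s; apply: posM; first exact: pos_qX.
  apply: posD; first apply: posD.
  - by apply: posM; [exact: pos_qX | apply: posM; exact: pos_gauss].
  - apply: posM; first exact: pos_geom.
    by apply: posM; [exact: pos_qX | exact: pos_narayana].
  - apply: posM; [exact: pos_qX | apply: posM; first exact: pos_gauss].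
    by apply: posM; [exact: pos_gauss | exact: pos_geom].
rewrite -ssumD; apply: eq_ssum => s; rewrite add0n.
have narE : geom 2 * (q ^+ (s.*2 + 4) * narayana i s.+1)
    + geom 2 * narayana i.+1 s - q ^+ 2 * (geom 2 * narayana i.+1 s.+1)
  = narayana i.+1 s.+1 - q ^+ s.+1 * (gauss i.+1 s.+1 * gauss i s.+1)
    - q ^+ (s + i + 3) * (gauss i.+2 s * (gauss i s.+1 * geom s.+2)).
  have := narayana_rec i s; set X := q ^+ s.+1 * _; set Y := q ^+ (s + i + 3) * _ => recE.
  have := @geomK 2 isT => geom2.
  transitivity ((1 - q ^+ 2) * geom 2 * narayana i.+1 s.+1
    - geom 2 * (narayana i.+1 s.+1 - narayana i.+1 s - q ^+ (s.*2 + 4) * narayana i s.+1)).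
    ring.
  rewrite recE addrK (_ : geom 2 * ((1 - q ^+ 2) * (X + Y)) = (1 - q ^+ 2) * geom 2 * (X + Y)).
    by rewrite geom2; ring.
  ring.
(* The summand of [Psi i 0] expressed with one Narayana term, which [narE] then trades for the
   [geom 2] terms of [T] and [U]. *)
have certE : gauss i.+1 s.+1 * gauss i.+2 s - q ^+ (i + 4) * (gauss i.+1 s.+1 * gauss i.+2 s)
    - q * (gauss i s.+2 * gauss i.+2 s)
  = q ^+ (i + 6 + s) * (gauss i s.+2 * gauss i.+2 s) + q ^+ i.+2 * (gauss i.+1 s.+1 * Z s)
    - q ^+ (i + 4) * (gauss i.+1 s.+2 * gauss i.+2 s)
    - q ^+ s.+1 * (gauss i.+1 s.+1 * gauss i s.+1) + narayana i.+1 s.+1.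
  rewrite /Z /narayana !gaussE !addSn !addnS !qfactS (qfact_invE i) (qfact_invE i.+1) (qfact_invE s) (qfact_invE s.+1).
  rewrite !exprS !exprD; ring.
rewrite expr1 certE /U /T ZS doubleS (exprD _ i 4).
move: narE; set A := geom 2 * _; set B := geom 2 * narayana i.+1 s.
set C := geom 2 * narayana i.+1 s.+1 => narE.
have -> : narayana i.+1 s.+1 = A + B - q ^+ 2 * C
  + q ^+ s.+1 * (gauss i.+1 s.+1 * gauss i s.+1)
    + q ^+ (s + i + 3) * (gauss i.+2 s * (gauss i s.+1 * geom s.+2)).
  by rewrite narE; ring.
rewrite !exprS; ring.
Qed.

(** Splitting off a minor leaves [(1 - q ^+ (m + 3)) * ssum (Y m.+1)], which is [ssum (Y m)] by
    [YS]. *)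
Lemma pos_V0 m : pos (V 0 m).
Proof.
pose Y k s := q ^+ s.*2 * gauss k s.
have aY k : summable (Y k) by apply: summable_qX => s; lia.
have YS k : ssum (Y k.+1) = ssum (Y k) + q ^+ (k + 3) * ssum (Y k.+1).
  rewrite -ssum_mull //; apply: ssum_pascal => // [|s]; first by rewrite /Y !gaussk0.
  by rewrite /Y gauss_pascal doubleS !exprD !exprS; ring.
have -> : V 0 m = q ^+ 3 *
    (ssum (fun s => q ^+ s.*2 * (gauss m s.+1 * gauss 1 s - gauss 0 s.+1 * gauss m.+1 s)) + ssum (Y m)).
  have -> : ssum (Y m) = ssum (Y m.+1) - q ^+ (m + 3) * ssum (Y m.+1).
    by rewrite {1}YS addrK.
  rewrite -ssum_mull // -ssumB -ssumD -ssum_mull.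
    by apply: eq_ssum => s; rewrite /Y gauss0L !exprD; ring.
  have -> : (fun s => q ^+ s.*2 * (gauss m s.+1 * gauss 1 s - gauss 0 s.+1 * gauss m.+1 s)
      + (Y m.+1 s - q ^+ (m + 3) * Y m.+1 s))
    = (fun s => q ^+ s.*2 * (gauss m s.+1 * gauss 1 s - q ^+ (m + 3) * gauss m.+1 s)).
    by apply: funext => s; rewrite /Y gauss0L; ring.
  by apply: summable_qX => s; lia.
apply: posM; first exact: pos_qX.
apply: posD; apply: pos_ssum => s; apply: posM; try exact: pos_qX; last exact: pos_gauss.
exact: gauss_minor.
Qed.

Lemma pos_Psi i m : pos (Psi i m).
Proof. by case: m => [|m]; [exact: pos_Psi_0 | exact: pos_Psi_gt0]. Qed.

Theorem pos_crank_ge_sub_rank_ge m : pos (crank_ge m.+1 - rank_ge m.+1).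
Proof.
(* Telescoping with [S] subtracts [V] of the next size as well; adding it back against [N32] gives
   [Psi] by [V_sub_N32]. *)
pose S i := durfee_wt m i.+1 * (P1 i (m + i) + V i (m + i)).
have aS : summable S.
  move=> s n lt_ns; rewrite /S /durfee_wt coef_qXM ifT //; nia.
rewrite crank_ge_sub_rank_ge ssum_recl; last by apply: summable_qX => s; nia.
have -> : (fun e => durfee_wt m e.+1 * inner e.+1 (m + e.+1)) = (fun i =>
   (S i - S i.+1) + durfee_wt m i.+1 * (q ^+ (m + i.*2 + i + 9) * Psi i m)).
  apply: funext => i; rewrite -V_sub_N32 addnS inner_succ /S.
  rewrite (_ : durfee_wt m i.+2 = durfee_wt m i.+1 * q ^+ (i + (m + i) + 5)); last first.
    by rewrite /durfee_wt -exprD; congr (_ ^+ _); nia.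
  by rewrite [(m + i.+1)%N]addnS; ring.
rewrite ssumD ssum_telescope // addrA; apply: posD; last first.
  apply: pos_ssum => i; apply: posM; first exact: pos_qX.
  by apply: posM; [exact: pos_qX | exact: pos_Psi].
rewrite /S addn0 inner_0 (_ : durfee_wt m 1 = durfee_wt m 0 * q ^+ (m + 3)); last first.
  by rewrite /durfee_wt -exprD; congr (_ ^+ _); lia.
rewrite (_ : _ + _ = durfee_wt m 0 * ((1 - q) * ssum (fun s => q ^+ s * gauss m s))
  + durfee_wt m 0 * q ^+ (m + 3) * V 0 m); last by ring.
apply: posD; last first.
  by apply: posM; [apply: posM; exact: pos_qX | exact: pos_V0].
apply: posM; first exact: pos_qX.
have aF : summable (fun s => q ^+ s * gauss m s) by exact: summable_qX.
(* Multiplication by [1 - q] takes differences in [s], and [gauss m s] grows with [s]. *)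
rewrite mulrBl mul1r {1}ssum_recl // gaussk0 -ssum_mull // -addrA -ssumB.
apply: posD; first by rewrite mulr1; exact: pos_qX.
apply: pos_ssum => s; rewrite exprS (_ : _ - _ = q ^+ s.+1 * (gauss m s.+1 - gauss m s)).
  by apply: posM; [exact: pos_qX | exact: gauss_monoS].
by rewrite exprS; ring.
Qed.

(** Term [l.+1] of the first series and term [l] of the second carry the same power of [q]. *)
Lemma pos_rank_ge_sub m : pos (rank_ge m - rank_ge m.+1).
Proof.
rewrite /rank_ge {1}ssum_recl; last by apply: summable_qX => s; lia.
rewrite -addrA -ssumB; apply: posD; first by rewrite gaussk0 mulr1; exact: pos_qX.
apply: pos_ssum => l; rewrite !addnS !addSn -mulrBr.
by apply: posM; [exact: pos_qX | exact: gauss_monoS].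
Qed.

Theorem pos_rank_ge_sub_crank_ge m : pos (rank_ge m - crank_ge m.+1).
Proof.
have -> : rank_ge m - crank_ge m.+1 = q ^+ m.+1 * ((crank_ge m.+2 - rank_ge m.+2) + (rank_ge m.+2 - rank_ge m.+3)).
  rewrite -[rank_ge m](addrK (q ^+ m.+1 * rank_ge m.+3)) -[crank_ge m.+1](addrK (q ^+ m.+1 * crank_ge m.+2)).
  by rewrite rank_ge_rec crank_ge_rec; ring.
by apply: posM; [exact: pos_qX | apply: posD; [exact: pos_crank_ge_sub_rank_ge | exact: pos_rank_ge_sub]].
Qed.

(** * Counting partitions by rank and crank *)

(* In degrees above 1, counts the partitions with [w] ones and [u] parts larger
   than [w]; for [w = 0], those without ones whose largest part is [u]. *)
Definition crank_gf u w : fps := (1 - q) * (q ^+ (u * w + u + w) * (qfact_inv u * qfact_inv w)).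

Lemma crank_gfC u w : crank_gf u w = crank_gf w u.
Proof.
by rewrite /crank_gf [(w * u)%N]mulnC -!addnA [(w + u)%N]addnC [qfact_inv w * _]mulrC.
Qed.

(* Summing by parts over [w] turns the crank statistic into a Durfee rectangle. *)
Lemma crank_ge_crank_gf j : crank_ge j = ssum (fun w => ssum (fun t => crank_gf (w + j + t) w)).
Proof.
(* The sum over [t] is [(1 - q) * (q ^+ w * K w)]; Abel summation turns the sum over [w] into one of
   [(1 - q ^+ w.+1) * (K w - K w.+1)], and [KS] makes each a single Durfee term. *)
pose a w t := q ^+ (w.+1 * (w + j + t)) * qfact_inv (w + j + t).
pose K w := qfact_inv w * ssum (a w).
have aa w : summable (a w) by apply: summable_qX => t; nia.
have aq f : summable (fun w => q ^+ w * f w) by exact: summable_qX.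
have KS w : K w - K w.+1 = qfact_inv w.+1 * (q ^+ (w.+1 * (w + j)) * qfact_inv (w + j)).
  have -> : K w = qfact_inv w.+1 * ((1 - q ^+ w.+1) * ssum (a w)) by rewrite /K (qfact_invE w) mulrA.
  rewrite /K -mulrBr; congr (_ * _).
  have -> : ssum (a w.+1) = ssum (fun t => a w t.+1) - q ^+ w.+1 * ssum (a w).
    rewrite -ssum_mull // -ssumB; apply: eq_ssum => t.
    rewrite /a addnS !addSn (qfact_invE (w + j + t)) [in LHS]mulSn !mulnS !exprD !exprS; ring.
  rewrite (ssum_recl (aa w)) (_ : a w 0%N = q ^+ (w.+1 * (w + j)) * qfact_inv (w + j)) ?/a ?addn0 //; ring.
have aK : summable K.
  move=> w n lt_nw; rewrite /K fpsM big1 // => i _; rewrite /ssum big1 ?mulr0 // => t _.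
  by rewrite /a coef_qXM ifT //; have := leq_subr i n; nia.
transitivity (ssum (fun w => (1 - q) * (q ^+ w * K w))); last first.
  apply: eq_ssum => w; rewrite /K -ssum_mull // -!ssum_mull //; last first.
  - by apply: summable_mull; exact: aa.
  - by apply: summable_mull; apply: summable_mull; exact: aa.
  apply: eq_ssum => t; rewrite /crank_gf /a -[(w.+1 * _)%N]/((w + j + t) + w * (w + j + t))%N.
  by rewrite [((w + j + t) * w)%N]mulnC !exprD; ring.
rewrite ssum_mull // mulrBl mul1r {1}ssum_recl // expr0 mul1r -ssum_mull //.
rewrite -(ssum_telescope aK) -addrA -ssumB -ssumD; apply: eq_ssum => w.
transitivity ((1 - q ^+ w.+1) * (K w - K w.+1)); last by rewrite exprS; ring.
by rewrite KS (qfact_invE w); ring.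
Qed.

(** * Enumeration of partitions by largest part *)

Lemma mem_cands n k l : (size l <= k)%N -> all (fun x => (0 < x <= n)%N) l -> l \in cands n k.
Proof.
elim: k l => [|k IH] [|x l] //= le_lk /andP[x_in l_in].
by rewrite inE; apply/orP; right; apply: allpairs_f; [rewrite mem_iota; lia | exact: IH].
Qed.

Lemma mem_partitions n l : (l \in partitions n) = is_partition n l.
Proof.
rewrite mem_undup mem_filter; case: (boolP (is_partition n l)) => //= /and3P[_ l_gt0 /eqP sum_l].
apply: mem_cands.
  elim: l n l_gt0 sum_l => [|x l IH] n //= /andP[x_gt0 l_gt0] <-.
  have := IH _ l_gt0 erefl; lia.
apply/allP => x x_in; have x_gt0 := allP l_gt0 _ x_in; rewrite x_gt0 -sum_l sumnE.
by rewrite (big_rem x) //= leq_addr.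
Qed.

Lemma largest_part_cons x l : sorted geq (x :: l) -> largest_part (x :: l) = x.
Proof.
elim: l x => [|y l IH] x /=; first by rewrite maxn0.
by case/andP=> le_yx /IH /= ->; exact/maxn_idPl.
Qed.

Lemma sorted_geq_cons x l : sorted geq (x :: l) = (largest_part l <= x)%N && sorted geq l.
Proof.
case: l => [|y l] //; rewrite [in LHS]/=.
case: (boolP (sorted geq (y :: l))) => [sl|]; last by rewrite /= andbF => /negPf->; rewrite !andbF.
by rewrite largest_part_cons //; move: sl => /= ->.
Qed.

Lemma is_partition_cons n x l : is_partition n (x :: l) =
  [&& (0 < x)%N, (x <= n)%N, (largest_part l <= x)%N & is_partition (n - x) l].
Proof.
rewrite /is_partition sorted_geq_cons /=.
case: (_ <= x)%N; rewrite ?andbF //=; case: (sorted geq l); rewrite ?andbF //=.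
case: (all _ l); rewrite ?andbF //= ?andbT; case: x => //= x.
by case: leqP => [le_xn | lt_nx]; apply/eqP/eqP; lia.
Qed.

Lemma is_partition_nil n : is_partition n [::] = (n == 0%N).
Proof. by rewrite /is_partition /= eq_sym. Qed.

Definition bparts K n := [seq l <- partitions n | (largest_part l <= K)%N].

Lemma bparts_uniq K n : uniq (bparts K n).
Proof. by rewrite filter_uniq ?undup_uniq. Qed.

Lemma mem_bparts K n l : (l \in bparts K n) = (largest_part l <= K)%N && is_partition n l.
Proof. by rewrite mem_filter mem_partitions. Qed.

Lemma largest_part_le n l : is_partition n l -> (largest_part l <= n)%N.
Proof.
case: l => [|x l] //; rewrite is_partition_cons => /and4P[x_gt0 le_xn le_lx lP].
by rewrite largest_part_cons // sorted_geq_cons le_lx; case/andP: lP.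
Qed.

Lemma bparts_full K n : (n <= K)%N -> bparts K n = partitions n.
Proof.
move=> le_nK; apply/all_filterP/allP => l; rewrite mem_partitions => /largest_part_le le_ln.
exact: leq_trans le_nK.
Qed.

Lemma count_largest r n (Q : pred (seq nat)) : (0 < r)%N ->
  count (fun l => (largest_part l == r) && Q l) (partitions n) =
  if (n < r)%N then 0%N else count (fun l => Q (r :: l)) (bparts r (n - r)).
Proof.
move=> r_gt0; case: ltnP => [lt_nr | le_rn].
  apply/eqP; rewrite -leqn0 leqNgt -has_count; apply/hasPn => l.
  rewrite mem_partitions => /largest_part_le le_ln; rewrite negb_and.
  by apply/orP; left; apply/eqP; lia.
rewrite -(count_map (cons r) Q) -[RHS]size_filter -[LHS]size_filter.
have /perm_size <- : perm_eq [seq l <- [seq r :: l | l <- bparts r (n - r)] | Q l]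
    [seq l <- partitions n | (largest_part l == r) && Q l] => //.
apply: uniq_perm.
- by rewrite filter_uniq // map_inj_uniq ?bparts_uniq // => x y [].
- by rewrite filter_uniq ?undup_uniq.
move=> l; rewrite !mem_filter mem_partitions andbC [in RHS]andbAC; congr (_ && _).
apply/mapP/andP => [[l' + ->] | [/eqP lr lP]].
  rewrite mem_bparts => /andP[le_lr lP]; rewrite is_partition_cons r_gt0 le_rn le_lr lP.
  by rewrite largest_part_cons // sorted_geq_cons le_lr; case/andP: lP.
case: l lr lP => [|x l] lr lP; first by rewrite -lr in r_gt0.
have xr : x = r by rewrite -lr largest_part_cons //; case/andP: lP.
rewrite xr in lP *; exists l => //; rewrite mem_bparts.
by move: lP; rewrite is_partition_cons => /and4P[_ _ -> ->].
Qed.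

Definition bparts_gf K (P : pred (seq nat)) : fps := fun n => (count P (bparts K n))%:Z.

Lemma eq_bparts_gf K P P' : P =1 P' -> bparts_gf K P = bparts_gf K P'.
Proof. by move=> PP; apply: fps_ext => n; rewrite /bparts_gf (eq_count PP). Qed.

Lemma eq_in_bparts_gf K P P' : (forall n l, is_partition n l -> (largest_part l <= K)%N -> P l = P' l) ->
  bparts_gf K P = bparts_gf K P'.
Proof.
move=> PP; apply: fps_ext => n; rewrite /bparts_gf; congr Posz; apply: eq_in_count => l.
by rewrite mem_bparts => /andP[le_l /PP->].
Qed.

Lemma bparts_gf_pred0 K P : P =1 xpred0 -> bparts_gf K P = 0.
Proof. by move=> /eq_bparts_gf->; apply: fps_ext => n; rewrite /bparts_gf count_pred0. Qed.

Lemma bparts_gf_largest r Q : (0 < r)%N ->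
  (fun n => (count (fun l => (largest_part l == r) && Q l) (partitions n))%:Z) =
  q ^+ r * bparts_gf r (fun l => Q (r :: l)) :> fps.
Proof. by move=> r_gt0; apply: fps_ext => n; rewrite coef_qXM count_largest //; case: ltnP. Qed.

Lemma bparts_gf0 P : bparts_gf 0 P = if P [::] then 1 else 0.
Proof.
apply: fps_ext => n.
have -> : bparts_gf 0 P n = ((P [::] && (n == 0%N)) : nat)%:Z.
  rewrite /bparts_gf; congr Posz.
  have perm0 : perm_eq (bparts 0 n) (if n == 0%N then [:: [::]] else [::]).
    apply: uniq_perm; [exact: bparts_uniq | by case: eqP |] => -[|x l].
      by rewrite mem_bparts is_partition_nil; case: eqP.
    rewrite mem_bparts is_partition_cons /= geq_max.
    by case: x => [|x]; rewrite ?andbF /=; case: eqP.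
  by rewrite (permP perm0) andbC; case: eqP => //= _; case: (P _).
by case: (P [::]); rewrite ?fps1 //=; case: (n == 0)%N.
Qed.

Lemma bparts_gfS K P : bparts_gf K.+1 P = bparts_gf K P + q ^+ K.+1 * bparts_gf K.+1 (fun l => P (K.+1 :: l)).
Proof.
rewrite -bparts_gf_largest //; apply: fps_ext => n; rewrite fpsD /bparts_gf -PoszD; congr Posz.
rewrite /bparts !count_filter -count_predUI.
rewrite (eq_count (a2 := predI P (fun l => (largest_part l <= K.+1)%N))); last first.
  by move=> l /=; case: (P l); rewrite ?andbF //= andbT [(_ <= K.+1)%N]leq_eqVlt ltnS orbC.
rewrite (eq_count (a2 := pred0) (a1 := predI (predI _ _) _)) ?count_pred0 ?addn0 //.
move=> l /=; case: (P l) => //=; rewrite andbT.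
by apply/negP => /andP[le_lK /eqP lK]; rewrite lK ltnn in le_lK.
Qed.

(** Lowering each of the [b] parts by one leaves a partition in a box. *)
Lemma bparts_gf_size a b : bparts_gf a.+1 (fun l => size l == b) = q ^+ b * gauss a b.
Proof.
elim: a b => [|a IH] b.
  rewrite gauss0L mulr1; elim: b => [|b IHb]; rewrite bparts_gfS bparts_gf0 /=.
    by rewrite bparts_gf_pred0 // mulr0 addr0.
  by rewrite add0r expr1 IHb exprS.
elim: b => [|b IHb]; rewrite bparts_gfS IH /=.
  by rewrite bparts_gf_pred0 // mulr0 addr0 !gaussk0.
by rewrite IHb gauss_pascal !exprS; ring.
Qed.

Lemma largest_size_gf a b n :
  (count (fun l => (largest_part l == a.+1) && (size l == b.+1)) (partitions n))%:Z
  = (q ^+ (a + b).+1 * gauss a b) n.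
Proof.
have /(congr1 (fun f : fps => f n)) /= := @bparts_gf_largest a.+1 (fun l => size l == b.+1) isT.
by move=> ->; rewrite bparts_gf_size mulrA -exprD addSn.
Qed.

Definition ones (l : seq nat) := count (fun x => x == 1%N) l.

(* With [uppers], the two cases in the definition of the crank become one formula,
   [crankE], and its distribution becomes symmetric. *)
Definition uppers (l : seq nat) :=
  if ones l == 0%N then largest_part l else count (fun x => (ones l < x)%N) l.

Lemma crankE l : crank l = (uppers l)%:Z - (ones l)%:Z.
Proof. by rewrite /crank /uppers -/(ones l); case: eqP => [->|_]; rewrite ?subr0. Qed.

Lemma bparts_gf_geom K P : (0 < K)%N -> (forall l, P (K :: l) = P l) ->
  bparts_gf K P = geom K * bparts_gf K.-1 P.
Proof.
case: K => // K _ PK.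
have KE := bparts_gfS K P; rewrite (eq_bparts_gf _ PK) in KE.
have -> : bparts_gf K.+1.-1 P = (1 - q ^+ K.+1) * bparts_gf K.+1 P by rewrite mulrBl mul1r {1}KE addrK.
by rewrite mulrA [geom _ * _]mulrC geomK // mul1r.
Qed.

(** Fixing the number of ones replaces the factor [geom 1] by [q ^+ w]. *)
Lemma bparts_gf_ones w K : bparts_gf K.+1 (fun l => ones l == w) = q ^+ w * (1 - q) * qfact_inv K.+1.
Proof.
have q1 : (1 - q) * qfact_inv 1 = 1 by rewrite /qfact_inv big_ord1 -[in LHS](expr1 q) geomK.
elim: K => [|K IH].
  rewrite -mulrA q1 mulr1; elim: w => [|w IHw]; rewrite bparts_gfS bparts_gf0 /=.
    by rewrite bparts_gf_pred0 // mulr0 addr0.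
  by rewrite add0r expr1 exprS -IHw.
by rewrite bparts_gf_geom //= IH [qfact_inv K.+2]big_ord_recr /= mulrC mulrA.
Qed.

Definition ones_above w u (l : seq nat) :=
  (ones l == w) && (count (fun x => (w < x)%N) l == u).

(** The parts are [w] ones, free parts from 2 to [w], and [u] parts exceeding [w]; lowering the
    latter by [w.+1] puts them in a box of width [t]. *)
Lemma bparts_gf_ones_above w t u : (0 < w)%N -> bparts_gf (w.+1 + t) (ones_above w u) =
  q ^+ w * (1 - q) * qfact_inv w * (q ^+ (u * w.+1) * gauss t u).
Proof.
case: w => // w _.
have base v : bparts_gf w.+1 (ones_above w.+1 v) =
    if v is 0%N then q ^+ w.+1 * (1 - q) * qfact_inv w.+1 else 0.
  have above0 n l : is_partition n l -> (largest_part l <= w.+1)%N ->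
      count (fun x => (w.+1 < x)%N) l = 0%N.
    move=> _ le_lw; apply/eqP; rewrite -leqn0 leqNgt -has_count; apply/hasPn => x.
    rewrite -leqNgt; elim: l le_lw => [|y l IH] //=; rewrite geq_max inE => /andP[le_y /IH le_l].
    by case/orP => [/eqP->|/le_l].
  rewrite (@eq_in_bparts_gf w.+1 _ (fun l => (ones l == w.+1) && (0%N == v))); last first.
    by move=> n l lP le_l; rewrite /ones_above (above0 n).
  case: v => [|v]; last by apply: bparts_gf_pred0 => l; rewrite andbF.
  by rewrite -bparts_gf_ones; apply: eq_bparts_gf => l; rewrite andbT.
have step K v : (w < K)%N -> bparts_gf K.+1 (ones_above w.+1 v) = bparts_gf K (ones_above w.+1 v) +
    if v is v'.+1 then q ^+ K.+1 * bparts_gf K.+1 (ones_above w.+1 v') else 0.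
  move=> lt_wK; rewrite bparts_gfS; congr (_ + _).
  have consE l : ones_above w.+1 v (K.+1 :: l) =
      if v is v'.+1 then ones_above w.+1 v' l else false.
    rewrite /ones_above /ones /= ltnS lt_wK eqSS.
    by case: K lt_wK => // K _; case: v => [|v] //=; rewrite andbF.
  case: v consE => [|v] consE; first by rewrite bparts_gf_pred0 ?mulr0.
  by rewrite (eq_bparts_gf _ consE).
elim: t u => [|t IHt] u; elim: u => [|u IHu].
- by rewrite addn0 step // base addr0 mul0n gauss0L !mulr1.
- rewrite addn0 in IHu; rewrite addn0 step // base add0r IHu !gauss0L mulSn exprD; ring.
- rewrite addnS step ?IHt; last by lia.
  by rewrite addr0 !mul0n !gaussk0.
- rewrite addnS step ?IHt; last by lia.
  rewrite -addnS IHu gauss_pascal mulSn !exprD; ring.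
Qed.

Lemma crank_count_gf u w n : (1 < n)%N ->
  (count (fun l => (ones l == w) && (uppers l == u)) (partitions n))%:Z = crank_gf u w n.
Proof.
move=> n_gt1; case: w => [|w].
  rewrite (eq_count (a2 := fun l => (largest_part l == u) && (ones l == 0%N))); last first.
    by move=> l; rewrite /uppers andbC; case: (ones l == 0%N); rewrite ?andbF.
  rewrite /crank_gf muln0 addn0 qfact_inv0 mulr1.
  (* For [w = 0] the cases [u = 0] and [u = 1] have the series [1 - q] and [q], zero above degree 1,
     and no partitions there. *)
  case: u => [|u].
    rewrite qfact_inv0 mulr1 mulr1 fpsB fps1 (_ : q n = 0); last by rewrite /q; case: n n_gt1 => [|[]].
    case: n n_gt1 => // n n_gt1; rewrite subr0; congr Posz.
    apply/eqP; rewrite -leqn0 leqNgt -has_count; apply/hasPn => -[|x l].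
      by rewrite mem_partitions is_partition_nil.
    by rewrite mem_partitions is_partition_cons /= maxnE; case: x.
  have /(congr1 (fun f : fps => f n)) /= -> := @bparts_gf_largest u.+1 (fun l => ones l == 0%N) isT.
  case: u => [|u].
    rewrite bparts_gf_pred0 // mulr0 /qfact_inv big_ord1 mulrCA -[in RHS](expr1 q) geomK // mulr1 expr1.
    by rewrite /q; case: n n_gt1 => [|[]].
  have -> : (fun l => ones (u.+2 :: l) == 0%N) = (fun l => ones l == 0%N) by [].
  by rewrite bparts_gf_ones expr0 mul1r mulrCA.
rewrite (eq_count (a2 := ones_above w.+1 u)); last first.
  by move=> l; rewrite /uppers /ones_above; case: eqP => // ->.
(* With [t = n], the box factor agrees with [qfact_inv u] up to degree [n]. *)
have /(congr1 Posz) -> : count (ones_above w.+1 u) (partitions n) =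
    count (ones_above w.+1 u) (bparts (w.+2 + n) n) by rewrite bparts_full // leq_addl.
rewrite -[LHS]/(bparts_gf _ _ n) bparts_gf_ones_above //.
transitivity ((q ^+ w.+1 * (1 - q) * qfact_inv w.+1 * q ^+ (u * w.+2) * qfact_inv u) n); last first.
  rewrite /crank_gf; congr (fun f : fps => f n).
  by rewrite (_ : (u * w.+1 + u + w.+1 = w.+1 + u * w.+2)%N) ?exprD; [ring | lia].
rewrite mulrA; apply: (@eqto_mul n) => //; rewrite gaussC; exact: gauss_eqto.
Qed.

(** * Tail counts and symmetry of rank and crank *)

Lemma count_by_pair (T : Type) (s : seq T) (f g : T -> nat) (R : rel nat) M N :
    all (fun x => (f x < M)%N && (g x < N)%N) s ->
  (count (fun x => R (f x) (g x)) s)%:Z = \sum_(a < M) \sum_(b < N)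
     if R a b then (count (fun x => (f x == a) && (g x == b)) s)%:Z else 0.
Proof.
elim: s => [|x s IH] /=; first by rewrite big1 // => a _; rewrite big1 // => b _; case: (R a b).
case/andP=> /andP[fM gN] /IH{}IH; rewrite PoszD IH.
transitivity (\sum_(a < M) \sum_(b < N) ((if R a b then ((f x == a) && (g x == b) : nat)%:Z else 0)
   + (if R a b then (count (fun x => (f x == a) && (g x == b)) s)%:Z else 0))).
  under [RHS]eq_bigr => a _ do rewrite big_split /=.
  rewrite big_split /=; congr (_ + _).
  rewrite (bigD1 (Ordinal fM)) //= [X in _ + X]big1 ?addr0; last first.
    move=> a neq_a; rewrite big1 // => b _; case: ifP => // _.
    by rewrite (_ : (f x == a) = false) //; apply: contraNF neq_a => /eqP fa; apply/eqP/val_inj.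
  rewrite (bigD1 (Ordinal gN)) //= [X in _ + X]big1 ?addr0 ?eqxx //=; first by case: (R _ _).
  move=> b neq_b; case: ifP => // _.
  by rewrite (_ : (g x == b) = false) //; apply: contraNF neq_b => /eqP gb; apply/eqP/val_inj.
by apply: eq_bigr => a _; apply: eq_bigr => b _; case: ifP; rewrite ?PoszD ?addr0.
Qed.

Lemma is_partition_size n l : is_partition n l -> (size l <= n)%N.
Proof.
case/and3P=> _; elim: l n => [|x l IH] n //= /andP[x_gt0 l_gt0] /eqP <-.
have := IH _ l_gt0 (eqxx _); lia.
Qed.

Lemma partition_bounds n l : (0 < n)%N -> l \in partitions n ->
  [/\ (0 < largest_part l <= n)%N, (0 < size l <= n)%N, (ones l <= n)%N & (uppers l <= n)%N].
Proof.
move=> n_gt0; rewrite mem_partitions => lP.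
have le_sn := is_partition_size lP; have le_ln := largest_part_le lP.
have le_count P : (count P l <= n)%N by apply: leq_trans le_sn; exact: count_size.
split; first by rewrite le_ln andbT; case: l lP {le_sn le_ln le_count} => [|x l];
  [rewrite is_partition_nil; case: n n_gt0 | rewrite is_partition_cons /= leq_max => /andP[->]].
- rewrite le_sn andbT; case: l lP {le_sn le_ln le_count} => [|x l] //.
  by rewrite is_partition_nil; case: n n_gt0.
- exact: le_count.
- by rewrite /uppers; case: ifP.
Qed.

Lemma rank_count n (R : rel nat) M N : (0 < n)%N -> (n <= M)%N -> (n <= N)%N ->
  (count (fun l => R (largest_part l) (size l)) (partitions n))%:Z =
  \sum_(a < M) \sum_(b < N) if R a.+1 b.+1 then (q ^+ (a + b).+1 * gauss a b) n else 0.
Proof.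
move=> n_gt0 le_nM le_nN.
have predE l : l \in partitions n ->
    (largest_part l = (largest_part l).-1.+1) * (size l = (size l).-1.+1).
  by move=> /(partition_bounds n_gt0)[/andP[? _] /andP[? _] _ _]; rewrite !prednK.
rewrite (eq_in_count (a2 := fun l => R (largest_part l).-1.+1 (size l).-1.+1)); last first.
  by move=> l /predE lE; rewrite -!lE.
rewrite (@count_by_pair _ _ (fun l => (largest_part l).-1) (fun l => (size l).-1)
  (fun a b => R a.+1 b.+1) M N).
  apply: eq_bigr => a _; apply: eq_bigr => b _; case: ifP => // _.
  rewrite -largest_size_gf; congr Posz; apply: eq_in_count => l /predE lE.
  by rewrite [in RHS]lE [in X in _ = _ && X]lE !eqSS.
by apply/allP => l /(partition_bounds n_gt0)[/andP[? ?] /andP[? ?] _ _] /=; rewrite !prednK //; apply/andP; split;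
  [exact: leq_trans le_nM | exact: leq_trans le_nN].
Qed.

(** Conjugation of partitions, seen through [gaussC]. *)
Lemma rank_count_sym n (R : rel nat) : (0 < n)%N ->
  count (fun l => R (largest_part l) (size l)) (partitions n) =
  count (fun l => R (size l) (largest_part l)) (partitions n).
Proof.
move=> n_gt0; apply/eqP; rewrite -eqz_nat; apply/eqP.
rewrite (@rank_count n R n n) // (@rank_count n (fun a b => R b a) n n) // exchange_big.
by apply: eq_bigr => a _; apply: eq_bigr => b _; rewrite addnC gaussC.
Qed.

Lemma crank_count n (R : rel nat) M N : (1 < n)%N -> (n < M)%N -> (n < N)%N ->
  (count (fun l => R (uppers l) (ones l)) (partitions n))%:Z =
  \sum_(u < M) \sum_(w < N) if R u w then crank_gf u w n else 0.
Proof.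
move=> n_gt1 lt_nM lt_nN; rewrite (@count_by_pair _ _ uppers ones R M N).
  apply: eq_bigr => u _; apply: eq_bigr => w _; case: ifP => // _.
  by rewrite -crank_count_gf //; congr Posz; apply: eq_count => l; rewrite andbC.
apply/allP => l /(partition_bounds (ltnW n_gt1))[_ _ le1 le2].
by rewrite (leq_ltn_trans le2) // (leq_ltn_trans le1).
Qed.

Lemma crank_count_sym n (R : rel nat) : (1 < n)%N ->
  count (fun l => R (uppers l) (ones l)) (partitions n) =
  count (fun l => R (ones l) (uppers l)) (partitions n).
Proof.
move=> n_gt1; apply/eqP; rewrite -eqz_nat; apply/eqP.
rewrite (@crank_count n R n.+1 n.+1) // (@crank_count n (fun a b => R b a) n.+1 n.+1) //.
rewrite exchange_big.
by apply: eq_bigr => a _; apply: eq_bigr => b _; rewrite crank_gfC.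
Qed.

Lemma gauss_hockey a l : \sum_(b < l.+1) q ^+ b * gauss a b = gauss a.+1 l.
Proof.
elim: l => [|l IH]; first by rewrite big_ord1 !gaussk0 mulr1.
by rewrite big_ord_recr /= IH -gauss_pascalr.
Qed.

Lemma count_rank_ge n j : (0 < n)%N ->
  (count (fun l => (size l + j <= largest_part l)%N) (partitions n))%:Z = rank_ge j n.
Proof.
(* The first [j] values of the shifted largest part satisfy no inequality; what remains is indexed
   by [l], and [gauss_hockey] sums over the sizes. *)
move=> n_gt0; rewrite (@rank_count n (fun a b => (b + j <= a)%N) (j + n.+1) (n.+1)); try lia.
rewrite big_split_ord /= [X in X + _]big1 ?add0r; last first.
  move=> a _; rewrite big1 // => b _; rewrite ifF //.
  by apply/negbTE; have := ltn_ord a; lia.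
rewrite /rank_ge /ssum; apply: eq_bigr => l _.
rewrite -gauss_hockey mulr_sumr fps_sum -big_mkcond /=.
rewrite (big_ord_widen_cond n.+1 predT (fun b => (q ^+ (l + j).+1 * (q ^+ b * gauss (l + j) b)) n)) //=.
apply: eq_big => [b|b _]; first by rewrite addSn ltnS [(j + l)%N]addnC leq_add2r ltnS.
by rewrite mulrA -exprD addSn [(j + l)%N]addnC.
Qed.

Lemma crank_gf_gt u w n : (n < u)%N -> crank_gf u w n = 0.
Proof.
by move=> lt_nu; rewrite /crank_gf mulrCA coef_qXM ifT //; lia.
Qed.

Lemma count_crank_ge n j : (1 < n)%N ->
  (count (fun l => (ones l + j <= uppers l)%N) (partitions n))%:Z = crank_ge j n.
Proof.
move=> n_gt1.
(* The range of [u] still contains [n.+1] values after the first [w + j] are removed. *)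
rewrite (@crank_count n (fun u w => (w + j <= u)%N) (n + j + n.+1) n.+1); try lia.
rewrite crank_ge_crank_gf exchange_big; apply: eq_bigr => w _.
have le_wn : (w <= n)%N by rewrite -ltnS.
rewrite -(big_mkord predT (fun u => if (w + j <= u)%N then crank_gf u w n else 0)).
rewrite (@big_cat_nat _ _ _ (w + j)) //=; last by lia.
rewrite big_nat big1 ?add0r; last by move=> u /andP[_ lt_u]; rewrite leqNgt lt_u.
rewrite -{1}[(w + j)%N]add0n big_addn.
rewrite (@big_cat_nat _ _ _ n.+1) //=; last by lia.
rewrite [X in _ + X]big_nat [X in _ + X]big1 ?addr0.
  rewrite big_mkord /ssum; apply: eq_bigr => t _.
  by rewrite leq_addl [(t + _)%N]addnC.
by move=> t /andP[lt_t _]; rewrite leq_addl crank_gf_gt //; lia.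
Qed.

Lemma rank_le_crank n m : (1 < n)%N ->
  (count (fun l => (m.+1%:Z <= rank l)%R) (partitions n) <=
   count (fun l => (m.+1%:Z <= crank l)%R) (partitions n))%N.
Proof.
move=> n_gt1.
rewrite (eq_count (a2 := fun l => (size l + m.+1 <= largest_part l)%N)); last first.
  by move=> l; rewrite /rank; lia.
rewrite [X in (_ <= X)%N](eq_count (a2 := fun l => (ones l + m.+1 <= uppers l)%N)); last first.
  by move=> l; rewrite crankE; lia.
rewrite -lez_nat count_rank_ge ?count_crank_ge //; last exact: ltnW.
by have := @pos_crank_ge_sub_rank_ge m n; rewrite fpsB subr_ge0.
Qed.

Lemma crank_le_rank n m : (1 < n)%N ->
  (count (fun l => (m.+1%:Z <= crank l)%R) (partitions n) <=
   count (fun l => (m%:Z <= rank l)%R) (partitions n))%N.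
Proof.
move=> n_gt1.
rewrite [X in (_ <= X)%N](eq_count (a2 := fun l => (size l + m <= largest_part l)%N)); last first.
  by move=> l; rewrite /rank; lia.
rewrite (eq_count (a2 := fun l => (ones l + m.+1 <= uppers l)%N)); last first.
  by move=> l; rewrite crankE; lia.
rewrite -lez_nat count_rank_ge ?count_crank_ge //; last exact: ltnW.
by have := @pos_rank_ge_sub_crank_ge m n; rewrite fpsB subr_ge0.
Qed.

(** By symmetry, values below [- m] are as frequent as values at least [m.+1]; complementing
    [rank_le_crank] gives the claim. *)
Lemma crank_le_rank_neg n m : (1 < n)%N ->
  (count (fun l => (- m%:Z <= crank l)%R) (partitions n) <=
   count (fun l => (- m%:Z <= rank l)%R) (partitions n))%N.
Proof.
move=> n_gt1; have n_gt0 := ltnW n_gt1.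
have := rank_le_crank m n_gt1.
rewrite (eq_count (a2 := fun l => (size l + m.+1 <= largest_part l)%N)); last first.
  by move=> l; rewrite /rank; lia.
rewrite [X in (_ <= X)%N](eq_count (a2 := fun l => (ones l + m.+1 <= uppers l)%N)); last first.
  by move=> l; rewrite crankE; lia.
rewrite (@rank_count_sym n (fun a b => (b + m.+1 <= a)%N)) //.
rewrite (@crank_count_sym n (fun a b => (b + m.+1 <= a)%N)) // => le_count.
have := count_predC (fun l => (- m%:Z <= crank l)) (partitions n).
rewrite -(count_predC (fun l => (- m%:Z <= rank l)) (partitions n)).
rewrite (eq_count (a1 := predC (fun l => - m%:Z <= crank l))
  (a2 := fun l => (uppers l + m.+1 <= ones l)%N)); last first.
  by move=> l /=; rewrite crankE; lia.
rewrite (eq_count (a1 := predC (fun l => - m%:Z <= rank l))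
  (a2 := fun l => (largest_part l + m.+1 <= size l)%N)); last first.
  by move=> l /=; rewrite /rank; lia.
lia.
Qed.

(** * Comparing the two sorted lists *)

(** If entry [i] of [xs] were below [b], at most [size xs - i.+1] entries would reach [b], while at
    least [size ys - i] entries of [ys] reach [a]. *)
Lemma sorted_count_nth (xs ys : seq int) a b i :
    sorted <=%R xs -> sorted <=%R ys -> size xs = size ys -> (i < size xs)%N ->
    (count (fun y => (a <= y)%R) ys <= count (fun x => (b <= x)%R) xs)%N ->
  a <= nth 0 ys i -> b <= nth 0 xs i.
Proof.
move=> sx sy sz lt_i le_count le_a; rewrite leNgt; apply/negP => lt_b.
have nth_le (s : seq int) j k : sorted <=%R s -> (j <= k)%N -> (k < size s)%N ->
    nth 0 s j <= nth 0 s k.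
  move=> ss le_jk lt_k; apply: (sorted_leq_nth le_trans le_refl 0 ss) => //.
  by rewrite inE (leq_ltn_trans le_jk).
have : (count (fun y => (a <= y)%R) (drop i ys) = size ys - i)%N.
  rewrite -size_drop; apply/eqP; rewrite -all_count; apply/(all_nthP 0) => k.
  rewrite size_drop nth_drop => lt_k.
  by apply: le_trans le_a (nth_le _ _ _ sy (leq_addr k i) _); rewrite -ltn_subRL.
have : (count (fun x => (b <= x)%R) (take i.+1 xs) = 0)%N.
  apply/eqP; rewrite -leqn0 leqNgt -has_count; apply/negP => /(has_nthP 0)[k].
  rewrite size_takel // => lt_k; rewrite nth_take // => le_b.
  have := le_lt_trans (le_trans le_b (nth_le _ k i sx lt_k lt_i)) lt_b.
  by rewrite ltxx.
have := count_size (fun x => (b <= x)%R) (drop i.+1 xs); rewrite size_drop.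
move: le_count; rewrite -{1}(cat_take_drop i ys) -{1}(cat_take_drop i.+1 xs) !count_cat.
move=> {}le_count le_drop take_xs drop_ys; rewrite take_xs drop_ys add0n in le_count.
have := leq_trans (leq_trans (leq_addl _ _) le_count) le_drop.
by rewrite -sz subnS -ltnS prednK ?subn_gt0 // ltnn.
Qed.

Definition nonneg_part (x : int) : nat := if x is Posz k then k else 0.

Lemma sum_nonneg_part n (T : eqType) (s : seq T) (f : T -> int) :
    {in s, forall x, f x <= n%:Z} ->
  (\sum_(0 <= m < n.+1) m * count (fun x => f x == m%:Z) s = \sum_(x <- s) nonneg_part (f x))%N.
Proof.
elim: s => [|x s IH] f_le; first by rewrite big_nil big1 // => m _; rewrite muln0.
rewrite big_cons -IH => [|y y_in]; last by apply: f_le; rewrite inE y_in orbT.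
have -> : (nonneg_part (f x) = \sum_(0 <= m < n.+1) m * (f x == m%:Z))%N.
  have := f_le x (mem_head _ _); case: (f x) => k le_kn.
    rewrite (bigD1_seq k) ?iota_uniq ?mem_index_iota ?eqxx ?muln1 //=.
    rewrite big1 ?addn0 // => m; rewrite eqz_nat eq_sym => /negPf->.
    by rewrite muln0.
  by rewrite big1 //= => m _; rewrite muln0.
by rewrite -big_split; apply: eq_bigr => m _; rewrite /= mulnDr.
Qed.

Lemma nonneg_part_diff (c r : int) :
    (forall j, j.+1%:Z <= r -> j.+1%:Z <= c) ->
    (forall j, j.+1%:Z <= c -> j%:Z <= r) ->
    (forall j : nat, - j%:Z <= c -> - j%:Z <= r) ->
  nonneg_part c = (nonneg_part r + (c - r == 1)%R)%N.
Proof.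
case: c => [[|k]|k] r_c c_r c_r_neg.
- have := c_r_neg 0%N; case: r r_c {c_r c_r_neg} => [[|r]|r] r_c //.
  + by move=> _; have := r_c r; lia.
  + by rewrite oppr0 => /(_ isT).
- have := c_r k (lexx _); case: r r_c {c_r c_r_neg} => [[|r]|r] r_c /=; try lia.
  by have := r_c r (lexx _); lia.
- have := c_r_neg k.+1; rewrite NegzE lexx => /(_ isT).
  case: r r_c {c_r c_r_neg} => [[|r]|r] r_c /=; try lia.
  by have := r_c r (lexx _); lia.
Qed.

(** The comparison [diff] holds at every position however ties are broken, since only the sorted
    lists of values enter. *)
Lemma ospt_sorted n (L1 L2 : seq (seq nat)) : (1 < n)%N ->
    perm_eq L1 (partitions n) -> perm_eq L2 (partitions n) ->
    sorted (fun a b => crank a <= crank b) L1 -> sorted (fun a b => rank a <= rank b) L2 ->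
  ospt n = (\sum_(i < size L1) (crank (nth [::] L1 i) - rank (nth [::] L2 i) == 1)%R)%N.
Proof.
move=> n_gt1 perm1 perm2 sorted1 sorted2.
have n_gt0 := ltnW n_gt1.
have size12 : size L1 = size L2 by rewrite (perm_size perm1) (perm_size perm2).
have crank_le : {in partitions n, forall l, crank l <= n%:Z}.
  by move=> l /(partition_bounds n_gt0)[_ _ _ ?]; rewrite crankE; lia.
have rank_le : {in partitions n, forall l, rank l <= n%:Z}.
  by move=> l /(partition_bounds n_gt0)[/andP[_ ?] _ _ _]; rewrite /rank; lia.
pose c i := crank (nth [::] L1 i); pose r i := rank (nth [::] L2 i).
have diff i : (i < size L1)%N -> nonneg_part (c i) = (nonneg_part (r i) + (c i - r i == 1)%R)%N.
  move=> lt_i.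
  have lt_i2 : (i < size L2)%N by rewrite -size12.
  have sc : sorted <=%R (map crank L1) by rewrite sorted_map.
  have sr : sorted <=%R (map rank L2) by rewrite sorted_map.
  have szE : size (map crank L1) = size (map rank L2) by rewrite !size_map.
  have cE : nth 0 (map crank L1) i = c i by rewrite (nth_map [::]).
  have rE : nth 0 (map rank L2) i = r i by rewrite (nth_map [::]).
  have r_c a b : (count (fun l => (a <= rank l)%R) (partitions n) <=
      count (fun l => (b <= crank l)%R) (partitions n))%N -> a <= r i -> b <= c i.
    rewrite -(permP perm2 (fun l => a <= rank l)) -(permP perm1 (fun l => b <= crank l)).
    rewrite -(count_map rank (fun y => a <= y)).
    rewrite -(count_map crank (fun y => b <= y)) -cE -rE => le_count.
    by apply: (sorted_count_nth sc sr szE _ le_count); rewrite size_map.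
  have c_r a b : (count (fun l => (a <= crank l)%R) (partitions n) <=
      count (fun l => (b <= rank l)%R) (partitions n))%N -> a <= c i -> b <= r i.
    rewrite -(permP perm1 (fun l => a <= crank l)) -(permP perm2 (fun l => b <= rank l)).
    rewrite -(count_map crank (fun y => a <= y)).
    rewrite -(count_map rank (fun y => b <= y)) -cE -rE => le_count.
    by apply: (sorted_count_nth sr sc (esym szE) _ le_count); rewrite size_map -size12.
  apply: nonneg_part_diff => j.
  - exact/r_c/rank_le_crank.
  - exact/c_r/crank_le_rank.
  - exact/c_r/crank_le_rank_neg.
rewrite /ospt /Mcrank /Nrank !sum_nonneg_part // -(perm_big _ perm1) -(perm_big _ perm2) /=.
rewrite (big_nth [::]) [in X in _ - X](big_nth [::]) -size12 !big_mkord.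
have -> : (\sum_(i < size L1) nonneg_part (crank (nth [::] L1 i)) =
    \sum_(i < size L1) (nonneg_part (r i) + (c i - r i == 1)%R))%N.
  by apply: eq_bigr => i _; rewrite -diff.
by rewrite big_split /= PoszD addrAC subrr add0r.
Qed.

Local Close Scope ring_scope.

(* tau is any map arising as follows: L1 lists the partitions of n (each
   exactly once) in weakly increasing order of crank, L2 lists them in weakly
   increasing order of rank, and tau sends the i-th entry of L1 to the i-th
   entry of L2. *)
Theorem theorem1p8 (n : nat) (tau : seq nat -> seq nat) :
  1 < n ->
  (exists L1 L2 : seq (seq nat),
      [/\ perm_eq L1 (partitions n), perm_eq L2 (partitions n),
          sorted (fun a b => (crank a <= crank b)%R) L1,
          sorted (fun a b => (rank a <= rank b)%R) L2 &
          forall i, i < size L1 -> tau (nth [::] L1 i) = nth [::] L2 i]) ->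
  ospt n = Posz (count (fun l => (crank l - rank (tau l) == 1)%R) (partitions n)).
Proof.
move=> n_gt1 [L1 [L2 [perm1 perm2 sorted1 sorted2 tauE]]].
rewrite (ospt_sorted n_gt1 perm1 perm2 sorted1 sorted2) -(permP perm1).
rewrite -sum1_count (big_nth [::]) big_mkord [in RHS]big_mkcond; congr Posz.
by apply: eq_bigr => i _; rewrite tauE //; case: eqP.
Qed.
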